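(* Let $(\mathfrak g,\mathfrak h,\kappa)$ be a coral locally extended affine Lie algebra (LEALA) over a field $\mathbb K$ of characteristic zero for which there exists an integral weight $\lambda\in\mathfrak h^*$ with $$\Delta^\lambda:=\{\alpha\in\Delta:\lambda(\alpha^\sharp)=0\}\subseteq\Delta_i .$$ Then $(V,\Delta_i,(\cdot,\cdot))$, where $V:=\operatorname{span}_{\mathbb Q}\Delta_i$, is a locally affine root system or a locally finite root system.
   Context: $\mathbb K$ is a field of characteristic zero. A split Lie algebra is a pair $(\mathfrak g,\mathfrak h)$ where $\mathfrak h$ is a maximal abelian subalgebra of the $\mathbb K$-Lie algebra $\mathfrak g$ with $\operatorname{ad}\mathfrak h$ simultaneously diagonalizable. Put $\mathfrak g_\alpha=\{x\in\mathfrak g:[h,x]=\alpha(h)x\ \forall h\in\mathfrak h\}$ (so $\mathfrak g_0=\mathfrak h$) and $\Delta=\{\alpha\in\mathfrak h^*\setminus\{0\}:\mathfrak g_\alpha\ne\{0\}\}$. A root $\alpha$ is integrable if there exist $x_{\pm\alpha}\in\mathfrak g_{\pm\alpha}$ with $\alpha([x_\alpha,x_{-\alpha}])\neq0$ and $\operatorname{ad}x_{\pm\alpha}$ locally nilpotent; then $\dim\mathfrak g_{\pm\alpha}=1$ and the coroot $\check\alpha$ is the unique element of $[\mathfrak g_\alpha,\mathfrak g_{-\alpha}]$ with $\alpha(\check\alpha)=2$. $\Delta_i$ is the set of integrable roots; $\mathfrak g(\alpha)=\mathbb K\check\alpha+\mathfrak g_\alpha+\mathfrak g_{-\alpha}$.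 The core $\mathfrak g_c$ is the subalgebra generated by all $\mathfrak g(\alpha)$, $\alpha\in\Delta_i$; $\mathfrak g$ is coral if $\mathfrak g=\mathfrak h+\mathfrak g_c$. $\Delta_i$ is connected if any $\alpha,\beta\in\Delta_i$ are joined by a chain $\alpha=\alpha_0,\dots,\alpha_n=\beta$ in $\Delta_i$ with $\alpha_{j+1}(\check\alpha_j)\ne0$. A functional $\lambda\in\mathfrak h^*$ is an integral weight if $\lambda(\check\alpha)\in\mathbb Z$ for all $\alpha\in\Delta_i$. A split quadratic Lie algebra $(\mathfrak g,\mathfrak h,\kappa)$ is a split Lie algebra with a non-degenerate invariant symmetric bilinear form $\kappa$. The map $\flat:\mathfrak h\to\mathfrak h^*$, $h^\flat(x)=\kappa(x,h)$, is injective with $\Delta\subseteq\flat(\mathfrak h)$; for $\alpha\in\flat(\mathfrak h)$ put $\alpha^\sharp=\flat^{-1}(\alpha)$ and $(\alpha,\beta)=\kappa(\alpha^\sharp,\beta^\sharp)$. It is a LEALA if $\Delta_i$ is connected and every $\alpha\in\Delta$ with $(\alpha,\alpha)\ne0$ is integrable. Standing normalization: $\kappa$ is scaled so that $(\alpha,\alpha)\in\mathbb Q$, $(\alpha,\alpha)>0$ for all $\alpha\in\Delta_i$ (always possible for LEALAs; the form on $V$ is then rational and positive semidefinite). Let $V$ be a rational vector space with positive semidefinite bilinear form $(\cdot,\cdot)$ and $\mathcal R\subseteq V$. $(V,\mathcal R,(\cdot,\cdot))$ is a locally extended affine root system if: (A1) $(\alpha,\alpha)\ne0$ for $\alpha\in\mathcal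 R$ and $\operatorname{span}\mathcal R=V$; (A2) $\langle\beta,\alpha\rangle:=2(\alpha,\beta)/(\alpha,\alpha)\in\mathbb Z$ for $\alpha,\beta\in\mathcal R$; (A3) $\beta-\langle\beta,\alpha\rangle\alpha\in\mathcal R$ for $\alpha,\beta\in\mathcal R$; (A4) if $\mathcal R=\mathcal R_1\cup\mathcal R_2$ with $(\mathcal R_1,\mathcal R_2)\subseteq\{0\}$, then $\mathcal R_1$ or $\mathcal R_2$ is empty. It is locally affine if moreover (A5) $V^0:=\{v\in V:(v,V)=\{0\}\}$ intersects $\operatorname{span}_{\mathbb Z}\mathcal R$ in a non-trivial cyclic group. A locally finite root system is (in the sense of Loos–Neher) a spanning subset of non-zero vectors, meeting each finite-dimensional subspace in a finite set, with reflections preserving it and integral Cartan numbers; here this is the case $V^0=\{0\}$. *)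

(* Defs.v *)
From HB Require Import structures.
From mathcomp Require Import all_boot all_order all_algebra all_classical.

Set Implicit Arguments.
Unset Strict Implicit.
Unset Printing Implicit Defensive.

Import Order.TTheory GRing.Theory Num.Theory.
Local Open Scope ring_scope.
Local Open Scope classical_set_scope.

Section Span.
Variables (R : nzRingType) (V : lmodType R).
Implicit Types A : set V.

Definition lspan A : set V :=
  [set v | exists n (c : 'I_n -> R) (a : 'I_n -> V),
      (forall i, A (a i)) /\ v = \sum_i c i *: a i].

Definition in_lspan A : {pred V} := fun v => `[< lspan A v >].

Lemma in_lspan_submod A : submod_closed (in_lspan A).
Proof.
split=> [|k u v /asboolP[m [c [a [Aa ->]]]] /asboolP[n [d [b [Ab ->]]]]].
  apply/asboolP; exists 0%N, (fun=> 0), (fun=> 0).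
  by split=> [[] //|]; rewrite big_ord0.
apply/asboolP; exists (m + n)%N.
exists (fun i =>
  match fintype.split i with inl j => k * c j | inr j => d j end).
exists (fun i => match fintype.split i with inl j => a j | inr j => b j end).
split=> [i|]; first by case: (fintype.split i).
rewrite big_split_ord scaler_sumr; congr (_ + _); apply: eq_bigr => i _.
  by rewrite -[lshift _ _]/(unsplit (inl i)) unsplitK scalerA.
by rewrite -[rshift _ _]/(unsplit (inr i)) unsplitK.
Qed.

HB.instance Definition _ A :=
  GRing.isSubmodClosed.Build R V (in_lspan A)
    (GRing.submod_closed_semi (in_lspan_submod A)).

Definition span_type A := {v : V | v \in in_lspan A}.
HB.instance Definition _ A := SubChoice.on (span_type A).
HB.instance Definition _ A := [SubChoice_isSubLmodule of span_type A by <:].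

End Span.

Section Dual.
Variables (K : fieldType) (E : lmodType K).

Definition is_functional : {pred E -> K^o} := fun f => `[< scalar f >].

Lemma is_functional_submod : submod_closed is_functional.
Proof.
split=> [|k f g /asboolP f_lin /asboolP g_lin]; apply/asboolP=> a u v.
  by rewrite mulr0 addr0.
rewrite [LHS]/(k * f _ + g _) f_lin g_lin.
rewrite [RHS]/(a * (k * f u + g u) + (k * f v + g v)) /=.
by rewrite !mulrDr !mulrA [a * k]mulrC; apply: addrACA.
Qed.

HB.instance Definition _ :=
  GRing.isSubmodClosed.Build K (E -> K^o) is_functional
    (GRing.submod_closed_semi is_functional_submod).

Definition dual_space := {f : E -> K^o | f \in is_functional}.
HB.instance Definition _ := SubChoice.on dual_space.
HB.instance Definition _ := [SubChoice_isSubLmodule of dual_space by <:].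

Definition dual_fun (f : dual_space) : E -> K := val f.
Coercion dual_fun : dual_space >-> Funclass.

End Dual.

Section RatModule.
Variables (K : fieldType) (charK : [pchar K] =i pred0).

Let natK_eq0 (n : nat) : (n%:R == 0 :> K) = (n == 0)%N.
Proof. by move: n; apply/pcharf0P. Qed.

Let intK_neq0 (n : int) : n != 0 -> n%:~R != 0 :> K.
Proof.
by case: n => n n0; rewrite ?NegzE ?mulrNz ?oppr_eq0 -?pmulrn natK_eq0.
Qed.

Let ratrK_frac (a b : int) : b != 0 ->
  ratr (a%:Q / b%:Q) = a%:~R / b%:~R :> K.
Proof.
move=> b0; set q : rat := a%:Q / b%:Q; rewrite /ratr.
have dq0 : (denq q)%:~R != 0 :> K by rewrite intK_neq0 ?denq_neq0.
apply/eqP; rewrite eqr_div ?intK_neq0 //; apply/eqP; rewrite -!intrM.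
congr (_%:~R); apply: (@intr_inj rat); rewrite !intrM.
have b0Q : b%:Q != 0 by rewrite intr_eq0.
have dq0Q : (denq q)%:Q != 0 by rewrite intr_eq0 denq_neq0.
by apply/eqP; rewrite -eqr_div // divq_num_den.
Qed.

Lemma ratr_char0D : {morph (@ratr K) : p q / p + q}.
Proof.
move=> p q; have [p0 q0] := (denq_neq0 p, denq_neq0 q).
rewrite -{1}[p]divq_num_den -{1}[q]divq_num_den addf_div ?intr_eq0 //.
rewrite -!intrM -intrD ratrK_frac ?mulf_neq0 // intrD !intrM.
by rewrite -addf_div ?intK_neq0.
Qed.

Lemma ratr_char0M : {morph (@ratr K) : p q / p * q}.
Proof.
move=> p q; have [p0 q0] := (denq_neq0 p, denq_neq0 q).
rewrite -{1}[p]divq_num_den -{1}[q]divq_num_den mulf_div.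
by rewrite -!intrM ratrK_frac ?mulf_neq0 // !intrM mulf_div.
Qed.

(* The K-vector space E with scalars restricted along Q -> K. *)
Definition rat_mod (_ : [pchar K] =i pred0) (E : lmodType K) : Type := E.
Variable E : lmodType K.
Local Notation EQ := (rat_mod charK E).
HB.instance Definition _ := GRing.Zmodule.copy EQ E.

Let scaleQ (q : rat) (v : EQ) : EQ := (ratr q : K) *: (v : E).

Lemma rat_mod_scaleA a b v : scaleQ a (scaleQ b v) = scaleQ (a * b) v.
Proof. by rewrite /scaleQ scalerA ratr_char0M. Qed.

Lemma rat_mod_scale1 : left_id 1 scaleQ.
Proof.
by move=> v; rewrite /scaleQ /ratr (_ : numq 1 = 1) // (_ : denq 1 = 1) //
  divr1 scale1r.
Qed.

Lemma rat_mod_scaleDr : right_distributive scaleQ +%R.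
Proof. by move=> a u v; rewrite /scaleQ [LHS]scalerDr. Qed.

Lemma rat_mod_scaleDl v : {morph scaleQ^~ v : a b / a + b}.
Proof. by move=> a b; rewrite /scaleQ ratr_char0D [LHS]scalerDl. Qed.

HB.instance Definition _ := GRing.Zmodule_isLmodule.Build rat EQ
  rat_mod_scaleA rat_mod_scale1 rat_mod_scaleDr rat_mod_scaleDl.

End RatModule.

HB.mixin Record Lmodule_isLie (K : fieldType) g of GRing.Lmodule K g := {
  bracket : g -> g -> g;
  bracket_linearl : forall y : g, linear (bracket^~ y);
  bracket_linearr : forall x : g, linear (bracket x);
  bracket_alt : forall x : g, bracket x x = 0;
  bracket_jacobi : forall x y z : g,
    bracket x (bracket y z) + bracket y (bracket z x)
      + bracket z (bracket x y) = 0 }.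

#[short(type="lieAlgType")]
HB.structure Definition LieAlgebra (K : fieldType) :=
  {g of GRing.Lmodule K g & Lmodule_isLie K g}.

HB.instance Definition _ (K : fieldType) (g : lieAlgType K) :=
  bilinear_isBilinear.Build K g g g *:%R *:%R (@bracket K g)
    (pair (@bracket_linearl K g) (@bracket_linearr K g)).

Section LieAlgebraTheory.
Variables (K : fieldType) (g : lieAlgType K).
Implicit Types S A : set g.

Definition lie_subalgebra S : Prop :=
  [/\ S 0,
      forall a x y, S x -> S y -> S (a *: x + y) &
      forall x y, S x -> S y -> S (bracket x y)].

Definition lie_abelian S : Prop :=
  forall x y, S x -> S y -> bracket x y = 0.

Definition maximal_abelian S : Prop :=
  [/\ lie_subalgebra S, lie_abelian S &
      forall S', lie_subalgebra S' -> lie_abelian S' -> S `<=` S' -> S' = S].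

Definition lie_generated A : set g := smallest lie_subalgebra A.

Definition ad_locally_nilpotent (x : g) : Prop :=
  forall y : g, exists n : nat, iter n (bracket x) y = 0.

Definition invariant_form (kappa : {symmetric g}) : Prop :=
  forall x y z : g, kappa (bracket x y) z = kappa x (bracket y z).

Definition nondegenerate_form (kappa : {symmetric g}) : Prop :=
  forall x : g, (forall y, kappa x y = 0) -> x = 0.

End LieAlgebraTheory.

Definition is_integer (K : nzRingType) (x : K) : Prop :=
  exists n : int, x = n%:~R.

Section SplitLieAlgebra.
(* The subspace h of g is both a predicate hp on g and a vector space h of its
   own, with inclusion val : h -> g. *)
Variables (K : fieldType) (g : lieAlgType K) (hp : {pred g}).
Variable h : subLmodType hp.
Implicit Types (alpha beta : dual_space h) (x y z : g).

Definition root_space alpha : set g :=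
  [set x | forall t : h, bracket (val t) x = alpha t *: x].

Definition split_Lie : Prop :=
  maximal_abelian (range (val : h -> g)) /\
  lspan (\bigcup_(alpha in [set: dual_space h]) root_space alpha) = [set: g].

Definition is_root : set (dual_space h) :=
  [set alpha | alpha != 0 /\ exists2 x, root_space alpha x & x != 0].

Definition integrable_root : set (dual_space h) :=
  [set alpha | is_root alpha /\
    exists x y, [/\ root_space alpha x, root_space (- alpha) y,
      exists2 t : h, val t = bracket x y & alpha t != 0,
      ad_locally_nilpotent x & ad_locally_nilpotent y]].

(* Meaningful for integrable alpha only, where the defining condition has
   exactly one solution. *)
Definition coroot alpha : h :=
  xget 0 [set t : h |
    lspan [set bracket x y | x in root_space alpha
                           & y in root_space (- alpha)] (val t) /\
    alpha t = 2].

Definition sl2_of alpha : set g :=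
  [set z | exists c x y, [/\ root_space alpha x, root_space (- alpha) y &
                             z = c *: val (coroot alpha) + x + y]].

Definition core : set g :=
  lie_generated (\bigcup_(alpha in integrable_root) sl2_of alpha).

Definition coral : Prop :=
  forall z, exists (t : h) (y : g), core y /\ z = val t + y.

Definition integrable_roots_connected : Prop :=
  forall alpha beta, integrable_root alpha -> integrable_root beta ->
    exists s : seq (dual_space h),
      [/\ forall gamma, gamma \in s -> integrable_root gamma,
          path [rel a b : dual_space h | b (coroot a) != 0] alpha s &
          last alpha s = beta].

Definition integral_weight (lambda : dual_space h) : Prop :=
  forall alpha, integrable_root alpha -> is_integer (lambda (coroot alpha)).

Variable kappa : {symmetric g}.

Definition split_quadratic : Prop :=
  [/\ split_Lie, nondegenerate_form kappa & invariant_form kappa].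

(* Meaningful only for functionals of the form x |-> kappa x t, with t in h,
   among which are all the roots. *)
Definition sharp alpha : h :=
  xget 0 [set t : h | forall s : h, alpha s = kappa (val s) (val t)].

Definition dual_form alpha beta : K :=
  kappa (val (sharp alpha)) (val (sharp beta)).

Definition LEALA : Prop :=
  [/\ split_quadratic, integrable_roots_connected &
      forall alpha, is_root alpha -> dual_form alpha alpha != 0 ->
        integrable_root alpha].

Definition normalized : Prop :=
  forall alpha, integrable_root alpha ->
    exists2 q : rat, 0 < q & dual_form alpha alpha = ratr q.

Definition roots_orthogonal_to (lambda : dual_space h) : set (dual_space h) :=
  [set alpha | is_root alpha /\ lambda (sharp alpha) = 0].

Variable charK : [pchar K] =i pred0.

Definition root_rat_span : lmodType rat :=
  span_type (integrable_root : set (rat_mod charK (dual_space h))).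

Definition root_of (v : root_rat_span) : dual_space h := val v.

End SplitLieAlgebra.

Section RootSystems.
Variables (V : lmodType rat).
Implicit Types (B : {symmetric V}) (R : set V).

Definition cartan_number B (beta alpha : V) : rat :=
  2 * B alpha beta / B alpha alpha.

Definition form_radical B : set V := [set v | forall w, B v w = 0].

Definition locally_extended_affine_root_system B R : Prop :=
  [/\ forall v, 0 <= B v v,
      (forall a, R a -> B a a != 0) /\ lspan R = [set: V],
      forall a b, R a -> R b -> is_integer (cartan_number B b a),
      forall a b, R a -> R b -> R (b - cartan_number B b a *: a) &
      forall R1 R2, R = R1 `|` R2 ->
        (forall a b, R1 a -> R2 b -> B a b = 0) -> R1 = set0 \/ R2 = set0].

(* zmodule V is V as a Z-module: that span is the additive subgroup
   generated by R. *)
Definition locally_affine_root_system B R : Prop :=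
  locally_extended_affine_root_system B R /\
  exists2 d : V, d != 0 &
    form_radical B `&` lspan (R : set (zmodule V)) =
      [set d *~ n | n in [set: int]].

Definition locally_finite_root_system R : Prop :=
  [/\ lspan R = [set: V],
      ~ R 0,
      forall s : seq V, finite_set (R `&` lspan [set` s]) &
      forall a, R a -> exists f : {scalar V},
        f a = 2 /\
        forall b, R b -> is_integer (f b) /\ R (b - f b *: a)].

End RootSystems.

(* Main.v *)
From HB Require Import structures.
Require Import Defs.
From mathcomp Require Import all_boot all_order all_algebra all_classical.
From mathcomp Require Import ring lra zify.

Set Implicit Arguments.
Unset Strict Implicit.
Unset Printing Implicit Defensive.

Import Order.TTheory GRing.Theory Num.Theory.
Local Open Scope ring_scope.
Local Open Scope classical_set_scope.

(** Write R for the set of integrable roots and P for the set of all weights of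
    ad h that lie in V. The hypotheses make R connected, positive and spanning;
    what the Lie algebra contributes beyond that is three facts: the strings
    of P in the direction of a root of R are unbroken
    ([weight_string], from the highest weight theory of sl_2), R consists of
    the elements of P of nonzero norm, and a nonzero isotropic element of P is
    not annihilated by the functional phi : v |-> lambda(v^#), since it would
    otherwise be integrable.

    Cartan numbers are bounded by 4 ([cartan_le4]): a larger one would produce,
    in the middle of a root string, a weight of negative norm. Consequently
    finitely many roots S see only finitely many patterns of Cartan numbers
    ([transversal]), and the finite sum x |-> sum_b (b, x) b over
    representatives of these patterns is a Casimir operator: it commutes with
    the reflections in S, so it acts on a connected S by one positive scalar c
    modulo any subspace X that absorbs the choice of representatives
    ([casimir]). Two choices of X give the two main facts.
    - With X the orthogonal complement of S: c (x, x) = sum_b (b, x)^2, so the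
      form is positive semidefinite ([form_ge0]).
    - With X the rational span of the translations: if a and a + d are roots
      with d in the radical, the product of their reflections translates every
      root b by a multiple of d. Two roots in span S with the same pattern
      differ by such a d, and the Casimir operator kills the radical; hence the
      radical is contained in X ([radical_translation_span]).

    So for a root a and v in the radical, some nonzero multiple d of v
    satisfies: a + d is a root. The string from a + d in direction -a then
    passes through d, so that d is an isotropic weight, and phi(v) = 0 forces
    v = 0: phi is injective on the radical ([radical_phi_inj]). On the other
    hand phi takes values in a discrete group on the integral span of R,
    because lambda is integral and the norms of roots have bounded denominators
    relative to each other ([phi_discrete]). Thus the radical meets the
    integral span of R in a cyclic group ([radical_lattice_cyclic]). If this
    group is nontrivial, the system is locally affine. If it is trivial, then
    so is the radical, because every vector has a multiple in the integral
    span, and the form is positive definite; the finiteness of the set of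
    patterns then says that the system is locally finite. *)

(** * Linear spans and symmetric forms *)
Section LinearSpan.
Variables (R : nzRingType) (V : lmodType R).
Implicit Types (A C : set V) (u v : V).

Lemma lspan_sub A : A `<=` lspan A.
Proof.
move=> v Av; exists 1%N, (fun=> 1), (fun=> v); split=> //.
by rewrite big_ord1 scale1r.
Qed.

Lemma lspan0 A : lspan A 0.
Proof. by apply/asboolP; case: (in_lspan_submod A). Qed.

Lemma lspanP A k u v : lspan A u -> lspan A v -> lspan A (k *: u + v).
Proof.
move=> /asboolP Au /asboolP Av; apply/asboolP.
by case: (in_lspan_submod A) => _; apply.
Qed.

Lemma lspan_min A (C : set V) : C 0 ->
  (forall k u v, A u -> C v -> C (k *: u + v)) -> lspan A `<=` C.
Proof.
move=> C0 CP v [n [c [a [Aa ->]]]].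
by elim/big_rec: _ => // i w _; apply: CP.
Qed.

Lemma lspan_finite A v : lspan A v ->
  exists2 s : seq V, {subset s <= A} & lspan [set` s] v.
Proof.
move=> [n [c [a [Aa ->]]]]; exists (codom a).
  by move=> _ /codomP[i ->]; rewrite in_setE.
by exists n, c, a; split=> // i; apply: codom_f.
Qed.

Lemma lspan_mono A C : A `<=` C -> lspan A `<=` lspan C.
Proof.
move=> AC; apply: lspan_min; first exact: lspan0.
by move=> k u v Au; apply: lspanP; apply: lspan_sub; apply: AC.
Qed.

End LinearSpan.

Section SymmetricForm.
Variables (K : fieldType) (V : lmodType K) (B : {symmetric V}).
Implicit Types u v w : V.

Lemma symformC u v : B u v = B v u.
Proof. by rewrite hermC expr0 mul1r. Qed.

Lemma symformZl a u v : B (a *: u) v = a * B u v.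
Proof. by rewrite linearZl_LR. Qed.

Lemma symformZr a u v : B u (a *: v) = a * B u v.
Proof. by rewrite linearZr_LR. Qed.

Lemma symform0l v : B 0 v = 0. Proof. exact: linear0l. Qed.
Lemma symform0r v : B v 0 = 0. Proof. exact: linear0r. Qed.
Lemma symformNl u v : B (- u) v = - B u v. Proof. exact: linearNl. Qed.
Lemma symformNr u v : B u (- v) = - B u v. Proof. exact: linearNr. Qed.
Lemma symformDl u v w : B (u + v) w = B u w + B v w.
Proof. exact: linearDl. Qed.
Lemma symformDr u v w : B w (u + v) = B w u + B w v.
Proof. exact: linearDr. Qed.

Lemma symform_suml (I : Type) (r : seq I) (f : I -> V) v :
  B (\sum_(i <- r) f i) v = \sum_(i <- r) B (f i) v.
Proof. exact: linear_sumlz. Qed.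

Definition symformE :=
  (symform0l, symform0r, symformNl, symformNr, symformDl, symformDr,
   symformZl, symformZr).

Lemma orthogonal_lspan (S : set V) u v : (forall s, S s -> B u s = 0) ->
  lspan S v -> B u v = 0.
Proof.
move=> uS; suff : lspan S `<=` [set v | B u v = 0] by apply.
apply: lspan_min => [|k s w /uS us uw] /=; first by rewrite symform0r.
by rewrite symformDr symformZr us uw mulr0 addr0.
Qed.

End SymmetricForm.

(** * Reflections and connectedness *)
Section Roots.
Variables (V : lmodType rat) (B : {symmetric V}).
Implicit Types (a b c d u v w : V) (S C : set V).

Definition reflection a b := b - cartan_number B b a *: a.

(** Connectedness for the relation of non-orthogonality, as an induction
    principle: this spares the paths in most arguments. *)
Definition connected_set S := forall C,
  (exists2 a, S a & C a) ->
  (forall a b, S a -> S b -> C a -> B a b != 0 -> C b) -> S `<=` C.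

Lemma connected_setU S1 S2 a : connected_set S1 -> connected_set S2 ->
  S1 a -> S2 a -> connected_set (S1 `|` S2).
Proof.
move=> con1 con2 S1a S2a C [b Sb Cb] stepC.
have Ca : C a.
  case: Sb => Sb; [apply: con1 S1a | apply: con2 S2a]; try by exists b.
    by move=> c d Sc Sd; apply: stepC; left.
  by move=> c d Sc Sd; apply: stepC; right.
move=> c [] Sc; [apply: con1 Sc | apply: con2 Sc]; try by exists a.
  by move=> c' d Sc Sd; apply: stepC; left.
by move=> c' d Sc Sd; apply: stepC; right.
Qed.

Lemma connected_set1 a : connected_set [set a].
Proof. by move=> C [_ -> Ca] _ _ ->. Qed.

Lemma cartan_self a : B a a != 0 -> cartan_number B a a = 2.
Proof. by move=> a0; rewrite /cartan_number mulfK. Qed.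

Lemma cartanE a b : B a a != 0 -> 2 * B a b = cartan_number B b a * B a a.
Proof. by move=> a0; rewrite /cartan_number divfK. Qed.

Lemma reflection_isometry a : B a a != 0 ->
  forall u v, B (reflection a u) (reflection a v) = B u v.
Proof.
move=> a0 u v; rewrite /reflection !symformE /cartan_number.
by rewrite (symformC B u a); field.
Qed.

Lemma form_reflectionl a u v :
  B (reflection a u) v = B u v - cartan_number B u a * B a v.
Proof. by rewrite /reflection !symformE. Qed.

(** * Roots inside a set of weights with unbroken strings *)

(** R plays the part of the integrable roots, P that of all weights of ad h,
    zero included, and phi that of v |-> lambda(v^#). *)

Variables (R P : set V) (phi : {scalar V}).

Hypothesis rootE : forall v, R v <-> P v /\ B v v != 0.
Hypothesis root_pos : forall v, R v -> 0 < B v v.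
Hypothesis cartan_int : forall a b, R a -> P b ->
  is_integer (cartan_number B b a).
Hypothesis string : forall a b (j : nat), R a -> P b ->
  j%:R <= cartan_number B b a -> P (b - j%:R *: a).
Hypothesis root_connected : connected_set R.

Lemma root_neq0 a : R a -> B a a != 0.
Proof. by move=> /root_pos; rewrite lt0r => /andP[]. Qed.

Lemma root_weight a : R a -> P a.
Proof. by move=> /rootE[]. Qed.
Hint Resolve root_neq0 root_weight : core.

(** The string of a in its own direction runs from a to - a. *)
Lemma rootN a : R a -> R (- a).
Proof.
move=> Ra; apply/rootE; split; last by rewrite !symformE opprK root_neq0.
rewrite (_ : - a = a - 2%:R *: a); last first.
  by rewrite scaler_nat mulr2n opprD addNKr.
by apply: string => //; [exact: root_weight | rewrite cartan_self ?root_neq0].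
Qed.

Lemma cartanN a b : cartan_number B b (- a) = - cartan_number B b a.
Proof. by rewrite /cartan_number !symformE opprK mulrN mulNr. Qed.

Lemma reflectionN a b : reflection (- a) b = reflection a b.
Proof. by rewrite /reflection cartanN scaleNr scalerN opprK. Qed.

Lemma reflection_root a b : R a -> R b -> R (reflection a b).
Proof.
move=> Ra Rb; apply/rootE; split; last first.
  by rewrite reflection_isometry ?root_neq0.
have nonneg c : R c -> 0 <= cartan_number B b c -> P (reflection c b).
  move=> Rc; rewrite /reflection.
  have [[n|n] En] := cartan_int Rc (root_weight Rb); rewrite En ?ler0z //.
  by move=> _; apply: string; [exact: Rc|exact: root_weight|rewrite En].
have [k0|k0] := leP 0 (cartan_number B b a); first exact: nonneg.
rewrite -reflectionN; apply: nonneg; first exact: rootN.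
by rewrite cartanN oppr_ge0 ltW.
Qed.

(** With k = <b, a> and j = k/2 rounded down, b - j a is a weight of norm
    (b, b) - j (k - j) (a, a), and (b, b) <= k (a, a). As j (k - j) > k once
    k > 4, this norm would be negative, hence nonzero, and the weight would be
    a root of negative norm. *)
Lemma cartan_le4_of_le a b : R a -> R b -> 0 < cartan_number B b a ->
  cartan_number B a b <= cartan_number B b a -> cartan_number B b a <= 4.
Proof.
move=> Ra Rb.
have Ek : 2 * B a b = cartan_number B b a * B a a by rewrite cartanE ?root_neq0.
have El : 2 * B a b = cartan_number B a b * B b b.
  by rewrite symformC cartanE ?root_neq0.
have str := @string a b _ Ra (root_weight Rb).
have aP := root_pos Ra; have bP := root_pos Rb.
move: Ek El str.
case: (cartan_int Ra (root_weight Rb)) => -[k|k] ->; last by rewrite ltr0z.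
case: (cartan_int Rb (root_weight Ra)) => l -> Ek El str k0 lk.
have l0 : (0 : rat) < l%:~R.
  by rewrite -(pmulr_lgt0 _ bP) -El Ek mulr_gt0.
have {l0} l1 : (1 : rat) <= l%:~R by rewrite ltr0z in l0; rewrite ler1z.
case: leP => // k4; exfalso.
have {}k4 : (4 < k)%N by rewrite (ltr_nat rat 4 k) in k4.
pose j := k./2.
have /str : (j%:R : rat) <= k%:~R by rewrite ler_nat /j; lia.
set w := b - _ => Pw.
have jk : (k.+1 <= j * (k - j))%N by rewrite /j; nia.
have wE : B w w = B b b - (j * (k - j))%N%:R * B a a.
  rewrite natrM natrB; last by rewrite /j; lia.
  rewrite /w !symformE (symformC B b a).
  have -> : B a b = k%:R * B a a / 2 by rewrite -[k%:R * _]Ek; field.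
  by field.
have w0 : B w w < 0.
  have : (k.+1)%:R <= ((j * (k - j))%N%:R : rat) by rewrite ler_nat.
  rewrite -addn1 natrD wE => jk'.
  have : B b b <= k%:R * B a a by rewrite -[k%:R * _]Ek El ler_peMl // ltW.
  nra.
have Rw : R w by apply/rootE; rewrite lt_eqF.
by have := root_pos Rw; rewrite ltNge ltW.
Qed.

Lemma cartan_le4 a b : R a -> R b -> `|cartan_number B b a| <= 4.
Proof.
move=> Ra Rb.
wlog k0 : a Ra / 0 <= cartan_number B b a => [wl|].
  have [k0|k0] := leP 0 (cartan_number B b a); first exact: wl.
  by have := wl _ (rootN Ra); rewrite cartanN normrN oppr_ge0 => /(_ (ltW k0)).
rewrite ger0_norm //; move: k0; rewrite le_eqVlt => /predU1P[<- //|k0].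
have [lk|kl] := leP (cartan_number B a b) (cartan_number B b a).
  exact: cartan_le4_of_le.
apply: le_trans (ltW kl) _; apply: cartan_le4_of_le (ltW kl) => //.
exact: lt_trans kl.
Qed.

Lemma connected_cons (S : seq V) a b : connected_set [set` S] -> a \in S ->
  B a b != 0 -> connected_set [set` b :: S].
Proof.
move=> con Sa ab C [x Sx Cx] stepC.
have stepS c d : c \in S -> d \in S -> C c -> B c d != 0 -> C d.
  by move=> Sc Sd; apply: stepC => /=; rewrite inE ?Sc ?Sd orbT.
have hd : b \in b :: S by rewrite mem_head.
have tl : a \in b :: S by rewrite inE Sa orbT.
have SC : (exists2 c, c \in S & C c) -> [set` S] `<=` C.
  by move=> [c Sc Cc]; apply: con stepS; exists c.
have Ca : C a.
  move: Sx => /=; rewrite inE => /predU1P[xb|Sx].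
    by apply: (stepC b) => //; rewrite -?xb // xb symformC.
  by apply: SC Sa; exists x.
move=> y /=; rewrite inE => /predU1P[->|Sy].
  exact: (stepC a).
by apply: SC Sy; exists a.
Qed.

(** Connectedness is of finite character, which reduces statements on V to
    finite connected sets of roots. *)
Lemma connecting_chain a b : R a -> R b -> exists S : seq V,
  [/\ a \in S, b \in S, {subset S <= R} & connected_set [set` S]].
Proof.
move=> Ra Rb; pose C := [set b | exists S : seq V,
  [/\ a \in S, b \in S, {subset S <= R} & connected_set [set` S]]].
suff /(_ b Rb) : R `<=` C by [].
apply: root_connected.
  exists a => //; exists [:: a]; rewrite mem_head; split=> //.
    by move=> x; rewrite inE => /eqP->; rewrite in_setE.
  rewrite (_ : [set` _] = [set a]); first exact: connected_set1.
  by apply/seteqP; split=> x /=; rewrite inE => /eqP.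
move=> c d Rc Rd [S [Sa Sc SR Scon]] cd; exists (d :: S); split.
- by rewrite inE Sa orbT.
- by rewrite mem_head.
- by move=> x; rewrite inE => /predU1P[->|/SR //]; rewrite in_setE.
- exact: connected_cons cd.
Qed.

Lemma connected_hull a (s : seq V) : R a -> {subset s <= R} -> exists S : seq V,
  [/\ a \in S, {subset s <= S}, {subset S <= R} & connected_set [set` S]].
Proof.
move=> Ra; elim: s => [|b s IHs] sR.
  by have [S [Sa _ SR Scon]] := connecting_chain Ra Ra; exists S.
have [|S1 [S1a sS1 S1R S1con]] := IHs.
  by move=> x xs; apply: sR; rewrite inE xs orbT.
have Rb : R b by rewrite -in_setE sR ?mem_head.
have [S2 [S2a S2b S2R S2con]] := connecting_chain Ra Rb.
exists (S1 ++ S2); split.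
- by rewrite mem_cat S1a.
- by move=> x; rewrite inE mem_cat => /predU1P[->|/sS1->//]; rewrite S2b orbT.
- by move=> x; rewrite mem_cat => /orP[/S1R|/S2R].
- rewrite (_ : [set` _] = [set` S1] `|` [set` S2]); last first.
    apply/seteqP; split=> x /=; rewrite mem_cat; first by move=> /orP.
    by move=> ?; apply/orP.
  exact: connected_setU S1a S2a.
Qed.

(** A root is seen by S only through its Cartan numbers, which are integers
    between -4 and 4: there are at most 9 ^ (size S) patterns, and F selects one
    root of R' for each pattern that occurs. *)
Lemma transversal (S : seq V) (R' : set V) : {subset S <= R} -> R' `<=` R ->
  exists F : seq V,
  [/\ uniq F, forall b, b \in F -> R' b,
      forall b c, b \in F -> c \in F -> {in S, B b =1 B c} -> b = c &
      forall b, R' b -> exists2 c, c \in F & {in S, B b =1 B c}].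
Proof.
move=> SR R'R.
pose code b : {ffun 'I_(size S) -> 'I_9} :=
  [ffun i : 'I_(size S) => inord (Num.truncn (cartan_number B b S`_i + 4))].
have codeE b c : R' b -> R' c -> code b = code c <-> {in S, B b =1 B c}.
  move=> /R'R Rb /R'R Rc; split=> [bc s Ss|bc]; last first.
    apply/ffunP=> i; rewrite !ffunE /cartan_number !(symformC B S`_i).
    by rewrite bc // mem_nth.
  have ltS : (index s S < size S)%N by rewrite index_mem.
  have /ffunP/(_ (Ordinal ltS)) := bc; rewrite !ffunE /= nth_index //.
  have Rs : R s by rewrite -in_setE SR.
  have natE d : R d -> exists2 n, cartan_number B d s + 4 = n%:R & (n < 9)%N.
    move=> Rd; have := cartan_le4 Rs Rd.
    case: (cartan_int Rs (root_weight Rd)) => z -> z4.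
    have {}z4 : `|z| <= 4 by rewrite -(ler_int rat) intr_norm.
    exists (absz (z + 4)); last by lia.
    by rewrite -[4]/(4%:~R) -intrD -[RHS]/((_%:Z)%:~R); congr _%:~R; lia.
  have [m Em m9] := natE _ Rb; have [n En n9] := natE _ Rc.
  rewrite Em En !natrK => /(congr1 val); rewrite /= !inordK // => mn.
  have : cartan_number B b s = cartan_number B c s.
    by apply: (addIr 4); rewrite Em En mn.
  rewrite /cartan_number !(symformC B s) => /(divIf (root_neq0 Rs)).
  by apply: mulfI.
pose rep t := xget 0 [set b | R' b /\ code b = t].
have repP t : `[< exists b, R' b /\ code b = t >] ->
    R' (rep t) /\ code (rep t) = t.
  by move=> /asboolP/(@xgetPex _ 0 [set b | R' b /\ code b = t]).
exists [seq rep t | t <- enum {: {ffun 'I_(size S) -> 'I_9}} &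
                    `[< exists b, R' b /\ code b = t >]]; split.
- rewrite map_inj_in_uniq; first by apply: filter_uniq; apply: enum_uniq.
  move=> t u.
  by rewrite !mem_filter => /andP[/repP[_ Et] _] /andP[/repP[_ Eu] _];
    rewrite -{2}Et -{2}Eu => ->.
- by move=> b /mapP[t]; rewrite mem_filter => /andP[/repP[? _] _] ->.
- move=> b c /mapP[t]; rewrite mem_filter => /andP[/repP[Rb Eb] _] ->.
  move=> /mapP[u]; rewrite mem_filter => /andP[/repP[Rc Ec] _] ->.
  by move=> /(codeE _ _ Rb Rc); rewrite Eb Ec => ->.
- move=> b Rb; have [Rc Ec] : R' (rep (code b)) /\ code (rep (code b)) = code b.
    by apply: repP; apply/asboolP; exists b.
  exists (rep (code b)); last by apply/codeE.
  apply/map_f; rewrite mem_filter mem_enum andbT.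
  by apply/asboolP; exists b.
Qed.

(** For a in S the reflection in a permutes F up to elements of X, and it
    changes the sign of (., a). Reindexing sum_b (b, a) b by this permutation
    and adding the two expressions gives c_a a modulo X with
    c_a = sum_b (b, a)^2 / (a, a). The operator is symmetric for B, so that
    c_a = c_s as soon as (a, s) <> 0, and connectedness makes c_a constant. *)
Lemma casimir (S : seq V) (R' X : set V) :
  {subset S <= R'} -> R' `<=` R ->
  (forall s b, s \in S -> R' b -> R' (reflection s b)) ->
  connected_set [set` S] ->
  X 0 -> (forall k u v, X u -> X v -> X (k *: u + v)) ->
  (forall x s, X x -> s \in S -> B x s = 0) ->
  (forall b c, R' b -> R' c -> {in S, B b =1 B c} -> X (b - c)) ->
  exists F (k : rat), 0 < k /\
    forall s, s \in S -> X (\sum_(b <- F) B b s *: b - k *: s).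
Proof.
move=> SR' R'R R'refl Scon X0 XP XS XR'.
have SR : {subset S <= R}.
  by move=> s /SR'; rewrite !in_setE; apply: R'R.
have [F [Funiq FR' Fsep Fcov]] := transversal SR R'R.
pose Phi a := \sum_(b <- F) B b a *: b.
pose c a : rat := (\sum_(b <- F) B b a ^+ 2) / B a a.
have Xsum (f : V -> rat) (g : V -> V) :
    (forall b, b \in F -> X (g b)) -> X (\sum_(b <- F) f b *: g b).
  by move=> Xg; rewrite big_seq; elim/big_rec: _ => // b w /Xg; apply: XP.
have PhiX a : a \in S -> X (Phi a - c a *: a).
  move=> Sa; have a0 : B a a != 0 by apply: root_neq0; rewrite -in_setE SR.
  (* sg is the permutation of F induced by the reflection in a *)
  have /choice[sg sgP] b : exists b', b \in F ->
      b' \in F /\ {in S, B (reflection a b) =1 B b'}.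
    have [bF|bF] := boolP (b \in F); last by exists b.
    have [b' ? ?] := Fcov _ (R'refl _ _ Sa (FR' _ bF)).
    by exists b'.
  have sga b : b \in F -> B (sg b) a = - B b a.
    move=> /sgP[_ <- //]; rewrite form_reflectionl -cartanE //.
    by rewrite (symformC B a b); ring.
  have sg_inj : {in F &, injective sg}.
    move=> b b' bF b'F sgbb'; apply: Fsep => // s Ss.
    have := sgP _ bF; rewrite sgbb' => -[_ /(_ _ Ss)].
    have [_ <- //] := sgP _ b'F; rewrite !form_reflectionl.
    have : B b a = B b' a by apply: oppr_inj; rewrite -!sga // sgbb'.
    by rewrite /cartan_number !(symformC B a) => ->; apply: addIr.
  have Fperm : perm_eq F (map sg F).
    have su : uniq (map sg F) by rewrite map_inj_in_uniq.
    rewrite perm_sym; apply: uniq_perm => //.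
    have [] := @uniq_min_size _ (map sg F) F su; last by [].
      by move=> _ /mapP[b /sgP[? _] ->].
    by rewrite size_map.
  have Phi2 : Phi a = - \sum_(b <- F) B b a *: sg b.
    rewrite /Phi (perm_big _ Fperm) /= big_map -sumrN !big_seq.
    by apply: eq_bigr => b bF; rewrite sga // scaleNr.
  have -> : Phi a - c a *: a =
      2^-1 *: (\sum_(b <- F) B b a *: (reflection a b - sg b)) + 0.
    have -> : \sum_(b <- F) B b a *: (reflection a b - sg b) =
        Phi a + Phi a - (2 * c a) *: a.
      rewrite {2}Phi2 /Phi /c -sumrB.
      rewrite mulrA mulr_sumr mulr_suml scaler_suml -sumrB.
      apply: eq_bigr => b _; rewrite /reflection !scalerBr scalerA.
      rewrite addrAC; congr (_ - _ *: _).
      by rewrite /cartan_number (symformC B a b) expr2; ring.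
    rewrite addr0 -mulr2n -scaler_nat scalerBr !scalerA mulVf ?pnatr_eq0 //.
    by rewrite scale1r mulKf ?pnatr_eq0.
  apply: XP => //; apply: Xsum => b bF; have [sF sgE] := sgP _ bF.
  by apply: XR' => //; [apply: R'refl => //|]; apply: FR'.
have PhiE a s : a \in S -> s \in S -> B (Phi a) s = c a * B a s.
  move=> Sa Ss; apply/eqP; rewrite -subr_eq0 -symformZl.
  by rewrite -symformNl -symformDl (XS _ _ (PhiX _ Sa) Ss).
have PhiC a s : B (Phi a) s = B (Phi s) a.
  rewrite /Phi !symform_suml; apply: eq_bigr => b _.
  by rewrite !symformZl mulrC.
have cE a s : a \in S -> s \in S -> B a s != 0 -> c a = c s.
  move=> Sa Ss as0; apply: (mulIf as0).
  by rewrite -PhiE // PhiC PhiE // symformC.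
case: {R'refl XS XR'} S => [|a S'] in SR SR' Scon Fcov Fsep PhiX PhiE cE *.
  by exists [::], 1.
have aS : a \in a :: S' by rewrite mem_head.
exists F, (c a); split; last first.
  move=> s Ss; rewrite -/(Phi s); suff -> : c a = c s by apply: PhiX.
  suff /(_ s Ss) : [set` a :: S'] `<=` [set s | c a = c s] by [].
  by apply: Scon; [exists a|move=> b d Sb Sd /= -> /cE->].
have Ra : R a by rewrite -in_setE SR.
apply: divr_gt0; last exact: root_pos.
have R'a : R' a by rewrite -in_setE SR'.
have [b bF ab] := Fcov a R'a.
rewrite lt0r psumr_eq0; last by move=> x _; apply: sqr_ge0.
rewrite sumr_ge0 ?andbT => [|x _]; last exact: sqr_ge0.
apply/allPn; exists b => //=; rewrite sqrf_eq0 -ab // root_neq0 //.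
Qed.

(** By linearity the operator is the same scalar on the whole span of S. *)
Lemma casimir_span (S : seq V) (R' X : set V) :
  {subset S <= R'} -> R' `<=` R ->
  (forall s b, s \in S -> R' b -> R' (reflection s b)) ->
  connected_set [set` S] ->
  X 0 -> (forall k u v, X u -> X v -> X (k *: u + v)) ->
  (forall x s, X x -> s \in S -> B x s = 0) ->
  (forall b c, R' b -> R' c -> {in S, B b =1 B c} -> X (b - c)) ->
  exists F (k : rat), 0 < k /\
    forall v, lspan [set` S] v -> X (\sum_(b <- F) B b v *: b - k *: v).
Proof.
move=> SR' R'R R'refl Scon X0 XP XS XR'.
have [F [k [k0 FX]]] := casimir SR' R'R R'refl Scon X0 XP XS XR'.
exists F, k; split=> //; apply: lspan_min.
  rewrite big1 ?scaler0 ?subrr // => b _.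
  by rewrite symform0r scale0r.
move=> l u v Su Xv; have := XP l _ _ (FX u Su) Xv.
congr (X _); rewrite scalerBr addrACA -opprD scalerDr !scalerA (mulrC l).
congr (_ - _); rewrite scaler_sumr -big_split; apply: eq_bigr => b _ /=.
by rewrite symformDr symformZr scalerA scalerDl.
Qed.

Hypothesis root_span : lspan R = [set: V].

Lemma span_hull v a : R a -> exists S : seq V,
  [/\ a \in S, {subset S <= R}, connected_set [set` S] & lspan [set` S] v].
Proof.
move=> Ra; have /lspan_finite[s sR sv] : lspan R v by rewrite root_span.
have [S [Sa sS SR Scon]] := connected_hull Ra sR.
by exists S; split=> //; apply: lspan_mono sv => x; apply: sS.
Qed.

Lemma no_roots v : R = set0 -> v = 0.
Proof.
move=> R0; have : lspan R v by rewrite root_span.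
suff : lspan R `<=` [set 0] by apply.
by apply: lspan_min => // k u w; rewrite R0.
Qed.

(** On the span of a finite connected S the form is, up to the positive Casimir
    scalar, the sum of squares sum_b (b, v)^2. *)
Lemma form_ge0 v : 0 <= B v v.
Proof.
have [R0|/set0P[a Ra]] := eqVneq R set0.
  by rewrite [v]no_roots // symform0l.
have [S [_ SR Scon Sv]] := span_hull v Ra.
pose X := [set x | forall s, s \in S -> B x s = 0].
have [||||||||F [k [k0 /(_ v Sv)]]] := @casimir_span S R X.
- by [].
- by [].
- move=> s b Ss; apply: reflection_root.
  by rewrite -in_setE SR.
- by [].
- by move=> s _; apply: symform0l.
- move=> l u w Xu Xw s Ss; rewrite symformDl symformZl.
  by rewrite Xu ?Xw // mulr0 addr0.
- by move=> x s; apply.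
- move=> b c _ _ bc s Ss; rewrite symformDl symformNl bc //.
  exact: subrr.
move=> Xv; have := orthogonal_lspan Xv Sv.
rewrite symformDl symform_suml symformNl symformZl => /eqP.
rewrite subr_eq0 => /eqP E.
rewrite -(pmulr_rge0 _ k0) -E; apply: sumr_ge0 => b _.
by rewrite symformZl -expr2 sqr_ge0.
Qed.

(** Cauchy-Schwarz for a semidefinite form. *)
Lemma isotropic_radical v : B v v = 0 -> form_radical B v.
Proof.
move=> v0 w; apply/eqP; apply: contraT => vw0; exfalso.
(* the parameter for which w + t v has norm -1 *)
pose t := - (B w w + 1) / (2 * B v w).
have := form_ge0 (w + t *: v).
rewrite !symformE v0 (symformC B w v) !mulr0 addr0 -addrA -mulr2n.
have -> : t * B v w *+ 2 = - (B w w + 1) by rewrite /t; field.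
by rewrite opprD addrA subrr add0r oppr_ge0 ler10.
Qed.

(** * Translations by radical vectors *)

Lemma cartan_radical a b d e : form_radical B d -> form_radical B e ->
  cartan_number B (b + e) (a + d) = cartan_number B b a.
Proof.
move=> d0 e0; rewrite /cartan_number !symformE d0 (symformC B a e) e0.
by rewrite (symformC B a d) !d0 !addr0.
Qed.

Lemma radicalP k d e : form_radical B d -> form_radical B e ->
  form_radical B (k *: d + e).
Proof. by move=> d0 e0 v; rewrite symformDl symformZl d0 e0 mulr0 addr0. Qed.

Lemma radical0 : form_radical B 0.
Proof. by move=> v; apply: symform0l. Qed.

Lemma radicalZ k d : form_radical B d -> form_radical B (k *: d).
Proof. by move=> d0; have := radicalP k d0 radical0; rewrite addr0. Qed.

(** The reflections in a and a + d differ only in the direction of the radical,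
    and their product in one order or the other is b |-> b +- <b, a> d. *)
Lemma root_translation a b d (m : int) :
  R a -> R (a + d) -> form_radical B d -> R b ->
  R (b + (m%:~R * cartan_number B b a) *: d).
Proof.
move=> Ra Rad d0 Rb; set k := cartan_number B b a.
have pos c : R c -> cartan_number B c a = k -> R (c + k *: d).
  move=> Rc Ek; have := reflection_root Rad (reflection_root Ra Rc).
  congr R; rewrite /reflection -[X in cartan_number _ X (a + d)]addr0.
  rewrite cartan_radical // ?Ek; last exact: radical0.
  have -> : cartan_number B (c - k *: a) a = - k.
    rewrite /cartan_number !symformE mulrDr [2 * B a c]cartanE ?root_neq0 //.
    by rewrite Ek; field; apply: root_neq0.
  by rewrite scaleNr opprK scalerDr addrA subrK.
have neg c : R c -> cartan_number B c a = k -> R (c - k *: d).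
  move=> Rc Ek; have := reflection_root Ra (reflection_root Rad Rc).
  congr R; rewrite /reflection -[X in cartan_number _ X (a + d)]addr0.
  rewrite cartan_radical // ?Ek; last exact: radical0.
  have -> : cartan_number B (c - k *: (a + d)) a = - k.
    rewrite /cartan_number !symformE mulrDr [2 * B a c]cartanE ?root_neq0 //.
    by rewrite (symformC B a d) d0 Ek; field; apply: root_neq0.
  by rewrite scaleNr opprK scalerDr opprD (addrC (- _)) addrA subrK.
have kE (x : rat) : cartan_number B (b + x *: d) a = k.
  by rewrite -[a]addr0 cartan_radical //; [apply: radical0|apply: radicalZ].
have itp (n : nat) : R (b + (n%:R * k) *: d).
  elim: n => [|n IHn]; first by rewrite mul0r scale0r addr0.
  have := pos _ IHn (kE _); congr R.
  by rewrite -addrA -scalerDl -[in RHS]addn1 natrD mulrDl mul1r.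
have itn (n : nat) : R (b - (n%:R * k) *: d).
  elim: n => [|n IHn]; first by rewrite mul0r scale0r subr0.
  have := IHn; rewrite -scaleNr => /neg/(_ (kE _)); congr R.
  by rewrite -addrA -scalerBl -[in RHS]addn1 natrD mulrDl mul1r -opprD scaleNr.
case: m => n; first exact: itp.
by rewrite NegzE mulrNz mulNr scaleNr; apply: itn.
Qed.

(** The rational span of the d in the radical for which a + d is a root,
    described by the multiples that do translate a. *)
Definition translation_span a : set V := [set d | form_radical B d /\
  exists2 N : int, N != 0 & forall m : int, R (a + (m * N)%:~R *: d)].

Lemma translation_span0 a : R a -> translation_span a 0.
Proof.
by move=> Ra; split; [exact: radical0|exists 1 => // m; rewrite scaler0 addr0].
Qed.

(** If a + d' and a + d'' are roots, then so are a + 2 d' and a + 2 d' + 2 d'',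
    whence the factor 2 in the common multiple chosen here. *)
Lemma translation_spanP a k d e : R a -> translation_span a d ->
  translation_span a e -> translation_span a (k *: d + e).
Proof.
move=> Ra [d0 [N N0 dR]] [e0 [M M0 eR]]; split; first exact: radicalP.
exists (2 * N * M * denq k) => [|m]; first by rewrite !mulf_neq0 ?denq_eq0.
have ea2 x c : form_radical B c -> cartan_number B (a + x *: c) a = 2.
  move=> c0; rewrite -{2}[a]addr0 cartan_radical; last exact: radicalZ.
    by rewrite cartan_self ?root_neq0.
  exact: radical0.
have Rd := root_translation 1 Ra (dR (m * M * numq k)) (radicalZ _ d0) Ra.
have := root_translation 1 Ra (eR (m * N * denq k)) (radicalZ _ e0) Rd.
congr R; rewrite [X in cartan_number B (_ + X) _]scalerA ea2 //.
rewrite cartan_self ?root_neq0 // -addrA; congr (_ + _).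
rewrite !scalerA scalerDr scalerA; congr (_ *: _ + _ *: _).
  by rewrite !intrM numqE; ring.
by rewrite !intrM; ring.
Qed.

(** The translations at c contain all 2 m d, and if (a, b) <> 0 a translation d
    at a gives the translation <b, a> d at b; so the rational span of the
    translations is the same at all roots. *)
Lemma translation_span_diff a c d : R a -> R c -> R (c + d) ->
  form_radical B d -> translation_span a d.
Proof.
move=> Ra Rc Rcd d0.
suff /(_ a Ra) : R `<=` [set a | translation_span a d] by [].
apply: root_connected => [|{}a b {}Ra Rb [_ [N N0 dR]] ab].
  exists c => //; split=> //; exists 2 => // m.
  have := root_translation m Rc Rcd d0 Rc.
  by rewrite cartan_self ?root_neq0 // intrM.
split=> //; have [k Ek] := cartan_int Ra (root_weight Rb).
exists (k * N); first rewrite mulf_neq0 //.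
  move: ab; apply: contra_neq => k0; apply: (@mulfI _ 2) => //.
  by rewrite cartanE ?root_neq0 // Ek k0 mul0r mulr0.
move=> m; have := root_translation m Ra (dR 1) (radicalZ _ d0) Rb.
by rewrite Ek scalerA mul1r !intrM mulrA.
Qed.

(** The Casimir operator, taken modulo the translations, annihilates v since v
    is orthogonal to all roots; as it is also a nonzero multiple of v, the
    vector v itself is zero modulo the translations. *)
Lemma radical_translation_span a v : R a -> form_radical B v ->
  translation_span a v.
Proof.
move=> Ra v0; have [S [_ SR Scon Sv]] := span_hull v Ra.
pose R' := R `&` lspan [set` S].
have [||||||||F [k [k0 /(_ v Sv)]]] := @casimir_span S R' (translation_span a).
- move=> s Ss; rewrite in_setE; split; first by rewrite -in_setE SR.
  exact: lspan_sub.
- by move=> b [].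
- move=> s b Ss [Rb Sb]; split.
    by apply: reflection_root; rewrite // -in_setE SR.
  rewrite /reflection addrC -scaleNr; apply: lspanP => //.
  exact: lspan_sub.
- by [].
- exact: translation_span0.
- by move=> *; apply: translation_spanP.
- by move=> x s [x0 _] _; apply: x0.
- move=> b c [Rb Sb] [Rc Sc] bc; apply: (translation_span_diff Ra Rc).
    by rewrite addrC subrK.
  apply: isotropic_radical; apply: (orthogonal_lspan (S := [set` S])).
    by move=> s Ss; rewrite symformDl symformNl bc // subrr.
  by rewrite addrC -scaleN1r; apply: lspanP.
rewrite big1 => [|b _]; last by rewrite symformC v0 scale0r.
move=> kv; have := translation_spanP (- k^-1) Ra kv (translation_span0 Ra).
rewrite addr0 add0r scalerN scaleNr opprK scalerA mulVf ?scale1r //.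
by rewrite gt_eqF.
Qed.

Hypothesis phi_isotropic : forall v, P v -> B v v = 0 -> phi v = 0 -> v = 0.

(** For a suitable N <> 0 the vector a + N v is a root with <a + N v, a> = 2,
    and the weight halfway on its string in direction a is N v. *)
Lemma radical_phi_inj v : form_radical B v -> phi v = 0 -> v = 0.
Proof.
move=> v0 phiv; have [R0|/set0P[a Ra]] := eqVneq R set0; first exact: no_roots.
have [_ [N N0 /(_ 1)]] := radical_translation_span Ra v0; rewrite mul1r.
set w := _ *: v => Raw; have w0 : form_radical B w by apply: radicalZ.
have Pw : P w.
  rewrite (_ : w = a + w - 1%:R *: a); last by rewrite scale1r addrC addKr.
  apply: string => //; first exact: root_weight.
  rewrite -[a in cartan_number _ _ a]addr0 cartan_radical //.
    by rewrite cartan_self ?root_neq0.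
  exact: radical0.
have : w = 0 by apply: phi_isotropic => //; rewrite linearZ /= phiv mulr0.
by move=> /eqP; rewrite scaler_eq0 intr_eq0 (negPf N0) => /eqP.
Qed.

(** * The intersection of the radical with the root lattice *)

(** Along a chain of roots, a reflection in the last root reached replaces a' by
    a root of the same length that is not orthogonal to the next one. *)
Lemma same_norm_root a b : R a -> R b ->
  exists2 a', R a' /\ B a' a' = B a a & B a' b != 0.
Proof.
move=> Ra Rb.
pose C := [set b | exists2 a', R a' /\ B a' a' = B a a & B a' b != 0].
suff /(_ b Rb) : R `<=` C by [].
apply: root_connected => [|c d Rc Rd [a' [Ra' Ea'] a'c] cd].
  by exists a => //; exists a; rewrite ?root_neq0.
have [a'd|a'd] := eqVneq (B a' d) 0; last by exists a'.
exists (reflection c a').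
  by split; [apply: reflection_root|rewrite reflection_isometry ?root_neq0].
rewrite form_reflectionl a'd sub0r oppr_eq0 mulf_neq0 //.
by rewrite /cartan_number symformC !mulf_neq0 ?invr_eq0 ?root_neq0.
Qed.

(** If (a', b) <> 0 the ratio of (b, b) to (a', a') is that of the integers
    <b, a'> and <a', b>, and the latter, of size at most 4, divides 12. *)
Lemma root_norm_int a b : R a -> R b -> is_integer (12 * B b b / B a a).
Proof.
move=> Ra Rb; have [a' [Ra' <-] a'b] := same_norm_root Ra Rb.
have [k Ek] := cartan_int Ra' (root_weight Rb).
have [l El] := cartan_int Rb (root_weight Ra').
have : k%:~R * B a' a' = l%:~R * B b b.
  by rewrite -Ek -El -!cartanE ?root_neq0 // symformC.
have l0 : l != 0.
  apply: contraNneq a'b => l0.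
  rewrite symformC -(mulrI_eq0 _ (@mulfI _ 2 _)) //.
  by rewrite cartanE ?root_neq0 // El l0 mul0r.
have : `|l| <= 4 by rewrite -(ler_int rat) intr_norm -El; apply: cartan_le4.
move=> l4 klE; have [m Em] : exists m : int, m * l = 12.
  have : l \in [:: -4; -3; -2; -1; 1; 2; 3; 4] by rewrite !inE; lia.
  rewrite !inE => /or4P[||| /or4P[||| /orP[]]] /eqP->;
    by [exists (-3)|exists (-4)|exists (-6)|exists (-12)
       |exists 12|exists 6|exists 4|exists 3].
exists (m * k); rewrite -[12]/(12%:~R) -Em !intrM.
rewrite -(mulrA m%:~R) -klE; field.
exact: root_neq0.
Qed.

Hypothesis phi_integral : forall v, R v -> is_integer (2 * phi v / B v v).

Lemma phi_discrete : exists2 q : rat, q != 0 &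
  forall v, lspan (R : set (zmodule V)) v -> exists n : int, phi v = q * n%:~R.
Proof.
have [R0|/set0P[a Ra]] := eqVneq R set0.
  by exists 1 => // v _; exists 0; rewrite [v]no_roots // linear0 mulr0.
(* 24 = 2 * 12, the factor 2 coming from phi b = lambda(coroot b) (b, b) / 2 *)
exists (B a a / 24); first by rewrite mulf_neq0 ?root_neq0.
apply: (@lspan_min int (zmodule V) _
  [set v : V | exists n : int, phi v = B a a / 24 * n%:~R]).
  by exists 0; rewrite linear0 mulr0.
move=> k u v Ru [n En].
have [m Em] := phi_integral Ru; have [l El] := root_norm_int Ra Ru.
exists (k * (l * m) + n); rewrite [LHS]linearD En intrD mulrDr; congr (_ + _).
rewrite [LHS]raddfMz /= -mulrzl !intrM -Em -El; field.
by rewrite !root_neq0.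
Qed.

(** By [phi_discrete] and [radical_phi_inj] this group embeds into the integers;
    a generator is a vector with the smallest positive value of phi. *)
Lemma radical_lattice_cyclic
    (D := form_radical B `&` lspan (R : set (zmodule V))) :
  D `<=` [set 0] \/ exists2 d : V, d != 0 & D = [set d *~ n | n in [set: int]].
Proof.
have [q q0 phiq] := phi_discrete.
have DP (k : int) u v : D u -> D v -> D (u *~ k + v).
  move=> [u0 Ru] [v0 Rv]; split; last exact: (@lspanP int (zmodule V)).
  by rewrite -scaler_int; apply: radicalP.
have D0 : D 0 by split; [apply: radical0|apply: (@lspan0 int (zmodule V))].
have DZ (k : int) u : D u -> D (u *~ k).
  by move=> /(DP k _ 0); rewrite addr0; apply.
have [D1|] := pselect (D `<=` [set 0]); [by left|right].
pose pos n := `[< (0 < n)%N /\ exists2 d, D d & phi d = q * n%:R >].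
have ex_pos : exists n, pos n.
  have [v Dv v0] : exists2 v, D v & v != 0.
    apply: contra_notP b => nex v Dv /=.
    by apply: contra_notP nex => /eqP; exists v.
  have [n En] := phiq _ Dv.2.
  have n0 : n != 0.
    apply: contraNneq v0 => n0; apply/eqP/radical_phi_inj; first exact: Dv.1.
    by rewrite En n0 mulr0.
  exists (absz n); apply/asboolP; split; first by rewrite absz_gt0.
  exists (v *~ sgz n); first exact: DZ.
  by rewrite raddfMz /= En -mulrzr -mulrA -intrM (mulrC n) -abszEsg pmulrn.
case: (ex_minnP ex_pos) => n /asboolP[n0 [d Dd Ed]] n_min.
exists d; first by apply: contraTneq n0 => d0; move/eqP: Ed;
  rewrite d0 linear0 eq_sym mulf_eq0 (negPf q0) pnatr_eq0 -leqn0 leqNgt.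
apply/seteqP; split=> [v Dv|_ [k _ <-]]; last exact: DZ.
have [m Em] := phiq _ Dv.2.
exists (m %/ n)%Z => //.
(* the remainder of v modulo d: phi is smaller on it than on d *)
pose w := d *~ - (m %/ n)%Z + v.
have Dw : D w by apply: DP.
have Ew : phi w = q * (m %% n)%Z%:~R.
  rewrite /w linearD raddfMz /= Em Ed -mulrzl {2}(divz_eq m n).
  by rewrite intrD mulrNz intrM; ring.
have r0 : (m %% n)%Z = 0.
  have n0' : n%:Z != 0 by lia.
  have := modz_ge0 m n0'; have := @ltz_pmod m n; case: (m %% n)%Z Ew => // r Ew.
  rewrite ltz_nat => /(_ n0) rn _; congr Posz; apply/eqP; rewrite -leqn0 leqNgt.
  apply/negP => r0; have := n_min r; rewrite leqNgt rn => nr.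
  suff : false by []. apply: nr; apply/asboolP; split=> //; by exists w.
have : w = 0 by apply: radical_phi_inj; [exact: Dw.1|rewrite Ew r0 mulr0].
by move/eqP; rewrite /w addrC mulrNz subr_eq0 => /eqP.
Qed.

Lemma lspan_torsion v : lspan R v ->
  exists2 N : int, N != 0 & lspan (R : set (zmodule V)) (v *~ N).
Proof.
have zspanP (k : int) u w : lspan (R : set (zmodule V)) u ->
    lspan (R : set (zmodule V)) w -> lspan (R : set (zmodule V)) (u *~ k + w).
  exact: (@lspanP int (zmodule V)).
have zspan0 := @lspan0 int (zmodule V) R.
move: v; apply: lspan_min => [|k u v Ru [N N0 vN]].
  by exists 1.
exists (N * denq k); first by rewrite mulf_neq0 ?denq_eq0.
rewrite (_ : _ *~ _ = u *~ (numq k * N) + (v *~ N *~ denq k + 0)).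
  apply: (zspanP (numq k * N)); first exact: (@lspan_sub int (zmodule V)).
  exact: zspanP.
rewrite addr0 mulrzDl -mulrzA; congr (_ + _).
by rewrite -!scaler_int scalerA !intrM numqE; congr (_ *: _); ring.
Qed.

Lemma roots_LEARS : locally_extended_affine_root_system B R.
Proof.
split.
- exact: form_ge0.
- by split=> // a; apply: root_neq0.
- by move=> a b Ra Rb; apply: cartan_int => //; apply: root_weight.
- by move=> a b; apply: reflection_root.
- move=> R1 R2 RE orth.
  have [->|/set0P[a R1a]] := eqVneq R1 set0; [by left|right].
  have RR1 : R `<=` R1.
    apply: root_connected; first by exists a => //; rewrite RE; left.
    move=> c d _; rewrite {1}RE => -[//|R2d] R1c.
    by rewrite (orth _ _ R1c R2d) eqxx.
  apply/seteqP; split=> // c R2c; have Rc : R c by rewrite RE; right.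
  by have := root_neq0 Rc; rewrite (orth _ _ (RR1 _ Rc) R2c) eqxx.
Qed.

(** A named copy, to carry the structure of a linear form. *)
Definition cartan_functional a : V -> rat := cartan_number B ^~ a.

Lemma cartan_functional_linear a : scalar (cartan_functional a).
Proof.
by move=> k u v; rewrite /cartan_functional /cartan_number !symformE; ring.
Qed.

HB.instance Definition _ a := GRing.isLinear.Build rat V rat *%R
  (cartan_functional a) (cartan_functional_linear a).

(** When the form is definite, a root in the span of S is determined by its
    products with S, so such roots are among the representatives of
    [transversal]. *)
Lemma anisotropic_locally_finite : form_radical B = [set 0] ->
  locally_finite_root_system R.
Proof.
move=> rad0; split=> //.
- by move=> /root_neq0; rewrite symform0l eqxx.
- move=> s; have [S SR sS] : exists2 S : seq V, {subset S <= R} &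
      lspan [set` s] `<=` lspan [set` S].
    elim: s => [|v s [S SR sS]].
      by exists [::].
    have /lspan_finite[S' S'R S'v] : lspan R v by rewrite root_span.
    exists (S' ++ S); first by move=> x; rewrite mem_cat => /orP[/S'R|/SR].
    apply: lspan_min => [|k u w /=]; first exact: lspan0.
    rewrite inE => /predU1P[->|us] Sw; apply: lspanP => //.
      apply: lspan_mono S'v => x /= xS'; by rewrite mem_cat xS'.
    have : lspan [set` S] u by apply: sS; apply: lspan_sub.
    apply: lspan_mono => x /= xS; by rewrite mem_cat xS orbT.
  have [F [_ FR' _ Fcov]] :=
    @transversal S (R `&` lspan [set` S]) SR (@subIsetl _ _ _).
  apply: (@sub_finite_set _ _ [set` F]); last exact: finite_seq.
  move=> b [Rb sb]; have Sb := sS _ sb.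
  have [c cF bc] := Fcov b (conj Rb Sb).
  suff : [set 0] (b - c) by move=> /eqP; rewrite subr_eq0 => /eqP->.
  rewrite -rad0; apply: isotropic_radical.
  apply: (orthogonal_lspan (S := [set` S])).
    by move=> x Sx; rewrite symformDl symformNl bc // subrr.
  by rewrite addrC -scaleN1r; apply: lspanP => //; case: (FR' c cF).
- move=> a Ra; exists (cartan_functional a : {scalar V}); split.
    by rewrite /= /cartan_functional cartan_self ?root_neq0.
  move=> b Rb /=; split; first by apply: cartan_int => //; apply: root_weight.
  exact: reflection_root.
Qed.

Theorem affine_or_finite : locally_affine_root_system B R \/
  [/\ locally_extended_affine_root_system B R, form_radical B = [set 0] &
      locally_finite_root_system R].
Proof.
case: radical_lattice_cyclic => [D0|[d d0 Dd]]; last first.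
  by left; split; [exact: roots_LEARS|exists d].
have rad0 : form_radical B = [set 0].
  apply/seteqP; split=> [v v0|_ ->]; last exact: radical0.
  have [N N0 RN] : exists2 N : int,
      N != 0 & lspan (R : set (zmodule V)) (v *~ N).
    by apply: lspan_torsion; rewrite root_span.
  have : v *~ N = 0.
    by apply: D0; split=> //; rewrite -scaler_int; apply: radicalZ.
  by move=> /eqP; rewrite -scaler_int scaler_eq0 intr_eq0 (negPf N0) => /eqP.
right; split=> //; first exact: roots_LEARS.
exact: anisotropic_locally_finite.
Qed.
End Roots.

(** * Rational scalars in characteristic zero *)
Section RationalScalars.
Variables (K : fieldType) (charK : [pchar K] =i pred0).

Lemma natr_char0_eq0 (n : nat) : (n%:R == 0 :> K) = (n == 0)%N.
Proof. by move: n; apply/pcharf0P. Qed.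

Lemma ratr_char0_inj : injective (@ratr K).
Proof.
have r0 : ratr 0 = 0 :> K by rewrite -[0]/(0%:~R) ratr_int.
have r1 : ratr 1 = 1 :> K by rewrite -[1]/(1%:~R) ratr_int.
move=> p q pq; apply/eqP; rewrite -subr_eq0; apply: contraT => pq0.
have : ratr (p - q) = 0 :> K.
  by apply: (@addIr _ (ratr q)); rewrite -(ratr_char0D charK) subrK add0r.
move=> /(congr1 ( *%R (ratr (p - q)^-1))).
rewrite -(ratr_char0M charK) mulVf // r1 mulr0 => /eqP.
by rewrite oner_eq0.
Qed.

Lemma ratr2 : ratr 2 = 2 :> K.
Proof. by rewrite -[2]/(2%:R) ratr_nat. Qed.

Lemma ratrV q : ratr q^-1 = (ratr q)^-1 :> K.
Proof.
have [->|q0] := eqVneq q 0.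
  by rewrite invr0 -[0 in LHS]/(0%:~R) -[0 in RHS]/(0%:~R) ratr_int invr0.
have r0 : ratr q != 0 :> K.
  apply: contraNneq q0 => q0; apply/eqP/ratr_char0_inj.
  by rewrite q0 -[0 in RHS]/(0%:~R) ratr_int.
apply: (mulfI r0); rewrite mulfV // -(ratr_char0M charK) mulfV //.
by rewrite -[1 in LHS]/(1%:~R) ratr_int.
Qed.

End RationalScalars.

(** * Lie brackets and functionals *)
Section Bracket.
Variables (K : fieldType) (g : lieAlgType K).
Implicit Types (x y z : g) (a : K).

Lemma bracketDl x y z : bracket (x + y) z = bracket x z + bracket y z.
Proof. exact: linearDl. Qed.
Lemma bracketDr x y z : bracket z (x + y) = bracket z x + bracket z y.
Proof. exact: linearDr. Qed.
Lemma bracketZl a x y : bracket (a *: x) y = a *: bracket x y.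
Proof. exact: linearZl_LR. Qed.
Lemma bracketZr a x y : bracket x (a *: y) = a *: bracket x y.
Proof. exact: linearZr_LR. Qed.
Lemma bracket0r x : bracket x 0 = 0.
Proof. exact: linear0r. Qed.
Lemma bracketNr x y : bracket x (- y) = - bracket x y.
Proof. exact: linearNr. Qed.

Lemma bracketC x y : bracket x y = - bracket y x.
Proof.
apply/eqP; rewrite -addr_eq0; apply/eqP.
have := bracket_alt (x + y); rewrite bracketDl !bracketDr !bracket_alt.
by rewrite add0r addr0.
Qed.

Lemma bracket_leibniz x y z :
  bracket x (bracket y z) = bracket (bracket x y) z + bracket y (bracket x z).
Proof.
have /eqP := bracket_jacobi x y z; rewrite -addrA addr_eq0 => /eqP ->.
by rewrite (bracketC z x) bracketNr (bracketC z) !opprD !opprK addrC.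
Qed.

Lemma iter_bracketZ a x y n :
  iter n (bracket (a *: x)) y = a ^+ n *: iter n (bracket x) y.
Proof.
elim: n => [|n IHn]; first by rewrite scale1r.
by rewrite !iterS IHn bracketZl bracketZr scalerA exprS.
Qed.

Lemma ad_locally_nilpotentZ a x :
  ad_locally_nilpotent x -> ad_locally_nilpotent (a *: x).
Proof.
move=> xnil y; have [n xn] := xnil y; exists n.
by rewrite iter_bracketZ xn scaler0.
Qed.

Lemma iter_last x y : ad_locally_nilpotent x -> y != 0 ->
  exists2 n, iter n (bracket x) y != 0 & iter n.+1 (bracket x) y = 0.
Proof.
move=> /(_ y) nil y0; have ex : exists n, iter n (bracket x) y == 0.
  by have [n /eqP] := nil; exists n.
case: (ex_minnP ex) => -[|n] /eqP xn min; first by rewrite -xn eqxx in y0.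
by exists n => //; apply: contraTN (ltnSn n) => /min; rewrite -leqNgt.
Qed.

Lemma iter_le_neq0 x y m n : (m <= n)%N -> iter n (bracket x) y != 0 ->
  iter m (bracket x) y != 0.
Proof.
move=> /subnK <-; rewrite iterD; apply: contraNneq => ->.
by elim: (n - m)%N => // k IHk; rewrite iterS (eqP IHk) bracket0r.
Qed.

End Bracket.

Section Dual.
Variables (K : fieldType) (E : lmodType K).
Implicit Types (f : dual_space E).

Lemma dualD f1 f2 t : dual_fun (f1 + f2) t = f1 t + f2 t.
Proof. by []. Qed.
Lemma dualZ a f t : dual_fun (a *: f) t = a * f t.
Proof. by []. Qed.
Lemma dual_is_scalar f : scalar f.
Proof. exact/asboolP/(valP f). Qed.

HB.instance Definition _ f :=
  GRing.isLinear.Build K E K *%R (dual_fun f) (dual_is_scalar f).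

Lemma dual_ext f1 f2 : f1 =1 f2 -> f1 = f2.
Proof. by move=> f12; apply/val_inj/funext. Qed.

Definition dualE := (dualD, dualZ).
End Dual.

(** * Root spaces of a split quadratic Lie algebra *)
Section SplitQuadratic.
Variables (K : fieldType) (charK : [pchar K] =i pred0).
Variables (g : lieAlgType K) (hp : {pred g}) (h : subLmodType hp).
Variable kappa : {symmetric g}.
Implicit Types (alpha beta : dual_space h) (x y z : g) (s t : h).
Hypothesis split_quad : split_quadratic h kappa.

Lemma cartan_valZ a t : val (a *: t) = a *: (val t : g).
Proof. exact: linearZ. Qed.

(** Unlike a root, a weight may be zero; root strings may pass through zero. *)
Definition weight : set (dual_space h) :=
  [set alpha | exists2 x, root_space alpha x & x != 0].

Lemma root_spaceZ a alpha x : root_space alpha x -> root_space alpha (a *: x).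
Proof. by move=> gx t; rewrite bracketZr gx !scalerA mulrC. Qed.

Lemma root_space_bracket alpha beta x y : root_space alpha x ->
  root_space beta y -> root_space (alpha + beta) (bracket x y).
Proof.
move=> gx gy t; rewrite bracket_leibniz gx gy bracketZl bracketZr.
by rewrite -scalerDl.
Qed.

Lemma root_space_cartan t : root_space (0 : dual_space h) (val t).
Proof.
move=> s; rewrite scale0r; have [[[_ ab _] _] _ _] := split_quad.
by apply: ab; [exists s|exists t].
Qed.

(** The subalgebra h + K z is abelian, so it equals h by maximality. *)
Lemma cartan_centralizer z : root_space (0 : dual_space h) z ->
  exists t : h, val t = z.
Proof.
move=> gz; have [[[[_ _ _] ab max] _] _ _] := split_quad.
have hz t : bracket (val t) z = 0 by rewrite gz scale0r.
pose S := [set x | exists (t : h) (a : K), x = val t + a *: z].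
have Sab : lie_abelian S.
  move=> _ _ [s [a ->]] [t [b ->]]; rewrite bracketDl !bracketDr.
  rewrite !bracketZl !bracketZr hz bracket_alt (bracketC z) hz.
  have -> : bracket (val s) (val t) = 0 by apply: ab; [exists s|exists t].
  by rewrite !scaler0 oppr0 !scaler0 !addr0.
have SP a x y : S x -> S y -> S (a *: x + y).
  move=> [s [b ->]] [t [c ->]]; exists (a *: s + t), (a * b + c).
  by rewrite linearP /= scalerDr scalerA scalerDl addrACA.
have S0 : S 0 by exists 0, 0; rewrite raddf0 scale0r addr0.
have SE : S = range (val : h -> g).
  apply: max => //; first by split=> // x y Sx Sy; rewrite Sab.
  by move=> _ [t _ <-]; exists t, 0; rewrite scale0r addr0.
suff [t _ <-] : range (val : h -> g) z by exists t.
by rewrite -SE; exists 0, 1; rewrite raddf0 scale1r add0r.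
Qed.

Lemma form_invariant x y z : kappa (bracket x y) z = kappa x (bracket y z).
Proof. by have [_ _] := split_quad; apply. Qed.

Lemma root_space_orthogonal alpha beta x y : root_space alpha x ->
  root_space beta y -> alpha + beta != 0 -> kappa x y = 0.
Proof.
move=> gx gy; apply: contraNeq => xy0; apply/eqP/dual_ext => t.
apply: (mulIf xy0); rewrite [RHS](_ : _ = 0); last exact: mul0r.
rewrite dualE mulrDl -(symformZl _ (alpha t)) -gx -symformZr -gy.
rewrite -form_invariant.
by rewrite (bracketC x) symformNl addrN.
Qed.

Lemma root_spaces_nondegenerate x :
  (forall alpha y, root_space alpha y -> kappa x y = 0) -> x = 0.
Proof.
move=> xg; have [[_ full] nondeg _] := split_quad; apply: nondeg => y.
have : lspan (\bigcup_(alpha in [set: dual_space h]) root_space alpha) y.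
  by rewrite full.
by apply: orthogonal_lspan => z [alpha _]; apply: xg.
Qed.

Lemma cartan_nondegenerate t : (forall s, kappa (val s) (val t) = 0) -> t = 0.
Proof.
move=> th; apply: val_inj; rewrite raddf0; apply: root_spaces_nondegenerate.
move=> alpha y gy; have [alpha0|alpha0] := eqVneq alpha 0; last first.
  by apply: root_space_orthogonal (root_space_cartan t) gy _; rewrite add0r.
have [s <-] : exists s : h, val s = y.
  by apply: cartan_centralizer; rewrite -alpha0.
by rewrite symformC.
Qed.

Definition dual_to t alpha : Prop := forall s, alpha s = kappa (val s) (val t).

(** As kappa is nondegenerate on h, a functional has at most one dual vector. *)
Lemma sharpE t alpha : dual_to t alpha -> sharp kappa alpha = t.
Proof.
move=> at_; have : dual_to (sharp kappa alpha) alpha.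
  by apply: (@xgetPex _ 0 [set t | dual_to t alpha]); exists t.
move=> as_; apply/eqP; rewrite -subr_eq0; apply/eqP/cartan_nondegenerate => s.
by rewrite raddfB symformDr symformNr -as_ -at_ subrr.
Qed.

Definition representable : set (dual_space h) :=
  [set alpha | exists t, dual_to t alpha].

Lemma sharpP alpha : representable alpha -> dual_to (sharp kappa alpha) alpha.
Proof. by move=> [t at_]; rewrite (sharpE at_). Qed.

Lemma sharp_linear a alpha beta : representable alpha -> representable beta ->
  dual_to (a *: sharp kappa alpha + sharp kappa beta) (a *: alpha + beta).
Proof.
move=> /sharpP ra /sharpP rb s.
by rewrite !dualE linearP /= symformDr symformZr -ra -rb.
Qed.

Lemma representableP a alpha beta : representable alpha ->
  representable beta -> representable (a *: alpha + beta).
Proof. by move=> ra rb; eexists; apply: sharp_linear. Qed.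

Lemma representable0 : representable 0.
Proof. by exists 0 => s; rewrite raddf0 symform0r. Qed.

Lemma sharpZD a alpha beta : representable alpha -> representable beta ->
  sharp kappa (a *: alpha + beta) = a *: sharp kappa alpha + sharp kappa beta.
Proof. by move=> ra rb; apply/sharpE/sharp_linear. Qed.

Lemma dual_formE alpha beta : representable alpha ->
  dual_form kappa alpha beta = alpha (sharp kappa beta).
Proof. by move=> /sharpP ra; rewrite ra symformC. Qed.

Lemma dual_formC alpha beta :
  dual_form kappa alpha beta = dual_form kappa beta alpha.
Proof. exact: symformC. Qed.

Lemma bracket_dual alpha x y : root_space alpha x -> root_space (- alpha) y ->
  exists2 t : h, val t = bracket x y &
    forall s, kappa (val s) (val t) = alpha s * kappa x y.
Proof.
move=> gx gy; have [|t Et] := @cartan_centralizer (bracket x y).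
  by rewrite -[0](subrr alpha); apply: root_space_bracket.
by exists t => // s; rewrite Et -form_invariant gx symformZl.
Qed.

(** Nondegeneracy pairs x in g_alpha with some y in g_{-alpha}, and the
    functional dual to [x, y] is kappa(x, y) alpha. *)
Lemma weight_representable alpha : weight alpha -> representable alpha.
Proof.
move=> [x gx x0].
have [y gy xy0] : exists2 y, root_space (- alpha) y & kappa x y != 0.
  apply: contra_neqP x0 => nex; apply: root_spaces_nondegenerate => beta y gy.
  have [ab|] := eqVneq (alpha + beta) 0; last first.
    exact: root_space_orthogonal gx gy.
  apply/eqP; apply: contra_notT nex => xy0; exists y => //.
  rewrite (_ : - alpha = beta) //.
  by apply/eqP; rewrite eq_sym -addr_eq0 addrC ab.
have [t _ ts] := bracket_dual gx gy.
exists ((kappa x y)^-1 *: t) => s.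
by rewrite cartan_valZ symformZr ts mulrC mulfK.
Qed.

Lemma bracket_sharp alpha x y : representable alpha ->
  root_space alpha x -> root_space (- alpha) y ->
  bracket x y = kappa x y *: val (sharp kappa alpha).
Proof.
move=> /sharpP ra gx gy; have [t <- ts] := bracket_dual gx gy.
rewrite -cartan_valZ; congr val; apply/eqP; rewrite -subr_eq0; apply/eqP.
apply: cartan_nondegenerate => s.
rewrite raddfB symformDr symformNr ts /= cartan_valZ symformZr -ra mulrC.
by rewrite subrr.
Qed.

Section IntegrableRoot.
Variable alpha : dual_space h.
Hypothesis alpha_int : integrable_root alpha.

Lemma integrable_weight : weight alpha.
Proof. by case: alpha_int => -[_ [x gx x0] _]; exists x. Qed.

Lemma integrable_representable : representable alpha.
Proof. exact/weight_representable/integrable_weight. Qed.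
Hint Resolve integrable_representable : core.

(** For x, y as in the definition of integrability, alpha([x, y]) is
    kappa(x, y) (alpha, alpha). *)
Lemma integrable_norm_neq0 : dual_form kappa alpha alpha != 0.
Proof.
have [_ [x [y [gx gy [t Et t0] _ _]]]] := alpha_int.
move: t0; apply: contraNneq.
rewrite dual_formE // => N0; have -> : t = kappa x y *: sharp kappa alpha.
  by apply: val_inj; rewrite Et cartan_valZ; apply: bracket_sharp.
by rewrite linearZ /= N0 mulr0.
Qed.

(** The brackets [g_alpha, g_{-alpha}] are multiples of alpha^#, and the
    condition alpha(t) = 2 determines the multiple. *)
Lemma corootE :
  coroot alpha = (2 / dual_form kappa alpha alpha) *: sharp kappa alpha.
Proof.
pose C := [set t : h | lspan [set bracket x y | x in root_space alpha
  & y in root_space (- alpha)] (val t) /\ alpha t = 2].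
have [Cs C2] : C (coroot alpha).
  apply: (@xgetPex _ 0 C).
  have [_ [x [y [gx gy [t Et t0] _ _]]]] := alpha_int.
  exists ((2 / alpha t) *: t); split; last by rewrite linearZ /= divfK.
  rewrite cartan_valZ Et -[_ *: _]addr0; apply: lspanP; last exact: lspan0.
  by apply: lspan_sub; exists x => //; exists y.
have [c Ec] : exists c, val (coroot alpha) = c *: val (sharp kappa alpha).
  move: Cs; apply: (@lspan_min _ _ _
    [set z | exists c, z = c *: val (sharp kappa alpha)]).
    by exists 0; rewrite scale0r.
  move=> a _ v [x gx [y gy <-]] [c ->]; exists (a * kappa x y + c).
  by rewrite (bracket_sharp _ gx gy) // scalerA scalerDl.
have {}Ec : coroot alpha = c *: sharp kappa alpha.
  by apply: val_inj; rewrite cartan_valZ.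
rewrite Ec -C2 Ec linearZ /= -dual_formE // mulfK ?integrable_norm_neq0 //.
Qed.

Lemma coroot2 : alpha (coroot alpha) = 2.
Proof.
by rewrite corootE linearZ /= -dual_formE // divfK ?integrable_norm_neq0.
Qed.

Lemma pairing_coroot beta : beta (sharp kappa alpha) =
  beta (coroot alpha) * dual_form kappa alpha alpha / 2.
Proof.
rewrite corootE linearZ /=; field.
by rewrite integrable_norm_neq0 -[2]/(2%:R) (natr_char0_eq0 charK).
Qed.

Lemma sl2_triple : exists e f, [/\ root_space alpha e, root_space (- alpha) f,
  bracket e f = val (coroot alpha), ad_locally_nilpotent e &
  ad_locally_nilpotent f].
Proof.
have [_ [x [y [gx gy [t Et t0] xnil ynil]]]] := alpha_int.
exists x, ((2 / alpha t) *: y); split=> //.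
- exact: root_spaceZ.
- rewrite bracketZr -Et -cartan_valZ; congr val.
  have Et' : t = kappa x y *: sharp kappa alpha.
    by apply: val_inj; rewrite Et cartan_valZ; apply: bracket_sharp.
  rewrite corootE {2}Et' scalerA; congr (_ *: _).
  rewrite Et' linearZ /= -dual_formE //.
  move: t0; rewrite Et' linearZ /= -dual_formE // mulf_eq0 negb_or.
  by move=> /andP[? ?]; field; apply/andP.
- exact: ad_locally_nilpotentZ.
Qed.

(** Applying e to a vector of weight beta as long as possible gives a highest
    weight vector v, of weight mu = beta(coroot) + 2 n. Then
    e f^(i+1) v = (i+1) (mu - i) f^i v, so that the last nonzero f^m v has
    mu = m, a natural number, and the f^i v for i <= m realize the string. *)
Lemma weight_string beta : weight beta ->
  exists2 k : int, beta (coroot alpha) = k%:~R &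
    forall j : nat, j%:Z <= k -> weight (beta - j%:R *: alpha).
Proof.
move=> [y gy y0]; have [e [f [ge gf ef enil fnil]]] := sl2_triple.
have iter_space (gam : dual_space h) u w del n : root_space gam u ->
    root_space del w -> root_space (del + n%:R *: gam) (iter n (bracket u) w).
  move=> gu gw; elim: n => [|n IHn]; first by rewrite scale0r addr0.
  rewrite (_ : _ + _ = gam + (del + n%:R *: gam)).
    exact: root_space_bracket.
  by rewrite addrCA -addn1 natrD scalerDl scale1r (addrC gam).
have [n] := iter_last enil y0; set v := iter n _ y; rewrite iterS -/v => v0 ev.
have gv : root_space (beta + n%:R *: alpha) v by apply: iter_space.
pose mu := beta (coroot alpha) + n%:R * 2.
pose w i := iter i (bracket f) v.
have gw i : root_space (beta + n%:R *: alpha - i%:R *: alpha) (w i).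
  by rewrite -scalerN; apply: iter_space.
have wS i : w i.+1 = bracket f (w i) by [].
have ew i : bracket e (w i.+1) = (i.+1%:R * (mu - i%:R)) *: w i.
  elim: i => [|i IHi]; rewrite wS bracket_leibniz ef gw.
    rewrite [w 0%N]/= ev bracket0r addr0 !dualE -scaleNr dualZ coroot2.
    by congr (_ *: _); rewrite /mu; ring.
  rewrite IHi bracketZr -[bracket f _]/(w i.+1) -scalerDl; congr (_ *: _).
  by rewrite -scaleNr !dualE coroot2 /mu -!natr1; ring.
have [m wm0 wm1] := iter_last fnil v0.
have muE : mu = m%:R.
  move: (ew m); rewrite [w m.+1]wm1 bracket0r => /esym/eqP.
  rewrite scaler_eq0 (negPf wm0) orbF mulf_eq0 natr_char0_eq0 //= subr_eq0.
  by move/eqP.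
exists (m%:Z - (n * 2)%:Z) => [|j jk].
  rewrite intrD mulrNz -!pmulrn natrM -muE /mu; ring.
(* n steps down from v lead back to the weight beta, j more to beta - j alpha *)
exists (w (n + j)%N); last by apply: iter_le_neq0 wm0; lia.
rewrite (_ : _ - _ = beta + n%:R *: alpha - (n + j)%:R *: alpha) //.
by rewrite natrD scalerDl opprD addrA addrK.
Qed.

End IntegrableRoot.
End SplitQuadratic.

(** * Descent of the form and of the integral weight to the rational span *)
Section RationalForm.
Variables (K : fieldType) (charK : [pchar K] =i pred0).
Variables (g : lieAlgType K) (hp : {pred g}) (h : subLmodType hp).
Variable kappa : {symmetric g}.
Hypothesis split_quad : split_quadratic h kappa.
Hypothesis norm_rat : normalized h kappa.

Local Notation V := (root_rat_span h charK).
Local Notation rat_mod := (rat_mod charK (dual_space h)).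
Implicit Types (u v w : V) (alpha beta : dual_space h).

(** The scalar action of Q on V is that of K restricted along [ratr]; rewriting
    with this equation avoids comparing the two module structures by
    unfolding. *)
Lemma root_ofP (q : rat) u v :
  root_of (q *: u + v) = ratr q *: root_of u + root_of v.
Proof. exact: (linearP (val : V -> rat_mod)). Qed.

Lemma root_of0 : root_of (0 : V) = 0.
Proof. exact: (raddf0 (val : V -> rat_mod)). Qed.

Lemma root_of_inj : injective (@root_of K g hp h charK).
Proof. exact: val_inj. Qed.

Lemma root_of_subMn u v (j : nat) :
  root_of (u - j%:R *: v) = root_of u - j%:R *: root_of v.
Proof.
rewrite addrC -scaleNr root_ofP addrC -scaleNr; congr (_ + _ *: _).
by rewrite pmulrn -mulrNz ratr_int mulrNz.
Qed.

Lemma root_lift (alpha : dual_space h) : integrable_root alpha ->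
  exists v : V, root_of v = alpha.
Proof.
move=> ai.
have ha : (alpha : rat_mod) \in
    in_lspan (@integrable_root K g hp h : set rat_mod).
  by apply/asboolP; apply: lspan_sub.
by exists (Sub (alpha : rat_mod) ha); rewrite /root_of SubK.
Qed.

Lemma integrable_span :
  lspan [set v : V | integrable_root (root_of v)] = [set: V].
Proof.
apply/seteqP; split=> // v _; have /asboolP[n [c [a [ai Ev]]]] := valP v.
have /choice[b Eb] : forall i, exists w : V, root_of w = a i.
  by move=> i; apply: root_lift; apply: ai.
exists n, c, b; split=> [i|]; first by rewrite /= Eb; apply: ai.
apply: val_inj; rewrite Ev raddf_sum /=; apply: eq_bigr => i _.
by congr (_ *: _); apply/esym/Eb.
Qed.

Lemma root_span_ind (C : set V) : C 0 ->
  (forall q u v, integrable_root (root_of u) -> C v -> C (q *: u + v)) ->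
  forall v, C v.
Proof.
move=> C0 CP v; have : lspan [set v : V | integrable_root (root_of v)] v.
  by rewrite integrable_span.
by apply: lspan_min.
Qed.

Lemma root_of_representable v : representable kappa (root_of v).
Proof.
apply: (root_span_ind (C := [set v | representable kappa (root_of v)])) v.
  by rewrite /= root_of0; apply: representable0.
move=> q u v ui rv; rewrite /=.
rewrite root_ofP; apply: representableP => //.
exact: (integrable_representable split_quad).
Qed.
Hint Resolve root_of_representable : core.

(** Only linearity on representable functionals is asked for, since [sharp] is
    not additive beyond them. *)
Lemma rational_functional (f : dual_space h -> K) :
  (forall a alpha beta, representable kappa alpha -> representable kappa beta ->
     f (a *: alpha + beta) = a * f alpha + f beta) ->
  (forall v, integrable_root (root_of v) ->
     exists q : rat, f (root_of v) = ratr q) ->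
  forall v, exists q : rat, f (root_of v) = ratr q.
Proof.
move=> f_lin f_int.
apply: (root_span_ind (C := [set v | exists q : rat, f (root_of v) = ratr q])).
  exists 0; rewrite root_of0 -[ratr _]/(ratr 0%:~R) ratr_int.
  have := f_lin (-1) 0 0 (representable0 _ _) (representable0 _ _).
  by rewrite scaler0 addr0 mulN1r addNr.
move=> q u v ui [r Er]; have [s Es] := f_int u ui; exists (q * s + r).
by rewrite root_ofP f_lin // Er Es (ratr_char0D charK) (ratr_char0M charK).
Qed.

Lemma dual_form_linear beta :
  forall a alpha alpha', representable kappa alpha ->
  representable kappa alpha' -> dual_form kappa (a *: alpha + alpha') beta =
    a * dual_form kappa alpha beta + dual_form kappa alpha' beta.
Proof.
move=> a al al' ra ra'; rewrite !(dual_formE split_quad) //.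
exact: representableP.
Qed.

Lemma dual_form_integrable alpha beta : integrable_root alpha ->
  representable kappa beta -> dual_form kappa beta alpha =
    beta (coroot alpha) * dual_form kappa alpha alpha / 2.
Proof.
by move=> ai rb; rewrite dual_formE // (pairing_coroot charK split_quad ai).
Qed.

(** For integrable roots, (beta, alpha) is half the product of the integer
    beta(coroot alpha) and the rational (alpha, alpha). *)
Lemma dual_form_rational u v :
  exists q : rat, dual_form kappa (root_of u) (root_of v) = ratr q.
Proof.
move: u; apply: (rational_functional
  (f := fun a => dual_form kappa a (root_of v))).
  exact: dual_form_linear.
move=> u ui; rewrite dual_formC.
move: v; apply: (rational_functional
  (f := fun b => dual_form kappa b (root_of u))).
  exact: dual_form_linear.
move=> v vi; rewrite dual_form_integrable //.
have [k -> _] := weight_string charK split_quad ui (integrable_weight vi).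
have [q _ ->] := norm_rat ui; exists (k%:~R * q / 2).
by rewrite !(ratr_char0M charK) (ratrV charK) (ratr2 K) ratr_int.
Qed.

Definition rational_form u v : rat := xget 0
  [set q : rat | dual_form kappa (root_of u) (root_of v) = ratr q].

Lemma rational_formE u v :
  ratr (rational_form u v) = dual_form kappa (root_of u) (root_of v).
Proof. exact/esym/(xgetPex 0 (dual_form_rational u v)). Qed.

Lemma rational_formC u v : rational_form u v = rational_form v u.
Proof.
by apply: (ratr_char0_inj charK); rewrite !rational_formE dual_formC.
Qed.

Lemma rational_form_linear w : scalar (rational_form^~ w).
Proof.
move=> q u v; apply: (ratr_char0_inj charK).
rewrite (ratr_char0D charK) (ratr_char0M charK) !rational_formE root_ofP.
exact: dual_form_linear.
Qed.

Lemma rational_form_bilinear :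
  bilinear_for (GRing.Scale.Law.clone rat rat *%R _)
    (GRing.Scale.Law.clone rat rat *%R _) rational_form.
Proof.
split=> [w|w]; first exact: rational_form_linear.
move=> q u v; rewrite !(rational_formC w); exact: rational_form_linear.
Qed.

HB.instance Definition _ := bilinear_isBilinear.Build rat V V rat _ _
  rational_form rational_form_bilinear.

Lemma rational_form_hermitian u v :
  rational_form u v = (-1) ^+ false * idfun (rational_form v u).
Proof. by rewrite expr0 mul1r rational_formC. Qed.

HB.instance Definition _ := isHermitianSesquilinear.Build rat V false idfun
  rational_form rational_form_hermitian.

Lemma exists_rational_form : exists B : {symmetric V},
  forall u v, ratr (B u v) = dual_form kappa (root_of u) (root_of v).
Proof. by exists (rational_form : {symmetric V}); apply: rational_formE. Qed.

Section RationalWeight.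
Variable lambda : dual_space h.
Hypothesis lambda_int : integral_weight lambda.

Lemma weight_sharp_rational v :
  exists q : rat, lambda (sharp kappa (root_of v)) = ratr q.
Proof.
move: v; apply: (rational_functional (f := fun a => lambda (sharp kappa a))).
  by move=> a al al' ra ra'; rewrite sharpZD // linearP.
move=> v vi; rewrite (pairing_coroot charK split_quad vi).
have [k ->] := lambda_int vi; have [q _ ->] := norm_rat vi.
exists (k%:~R * q / 2).
by rewrite !(ratr_char0M charK) (ratrV charK) (ratr2 K) ratr_int.
Qed.

Definition rational_weight v : rat :=
  xget 0 [set q : rat | lambda (sharp kappa (root_of v)) = ratr q].

Lemma rational_weightE v :
  ratr (rational_weight v) = lambda (sharp kappa (root_of v)).
Proof. exact/esym/(xgetPex 0 (weight_sharp_rational v)). Qed.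

Lemma rational_weight_linear : scalar rational_weight.
Proof.
move=> q u v; apply: (ratr_char0_inj charK).
rewrite (ratr_char0D charK) (ratr_char0M charK) !rational_weightE root_ofP.
by rewrite sharpZD // linearP.
Qed.

HB.instance Definition _ :=
  GRing.isLinear.Build rat V rat *%R rational_weight rational_weight_linear.

Lemma exists_rational_weight : exists phi : {scalar V},
  forall v, ratr (phi v) = lambda (sharp kappa (root_of v)).
Proof. by exists (rational_weight : {scalar V}); apply: rational_weightE. Qed.

End RationalWeight.
End RationalForm.

Theorem theorem2p8 (K : fieldType) (charK : [pchar K] =i pred0)
    (g : lieAlgType K) (hp : {pred g}) (h : subLmodType hp)
    (kappa : {symmetric g}) (lambda : dual_space h) :
  LEALA h kappa -> normalized h kappa -> coral h ->
  integral_weight lambda ->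
  roots_orthogonal_to kappa lambda `<=` @integrable_root _ _ _ h ->
  let V := root_rat_span h charK in
  let R := [set v : V | integrable_root (root_of v)] in
  exists B : {symmetric V},
    (forall u v : V, ratr (B u v) = dual_form kappa (root_of u) (root_of v)) /\
    (locally_affine_root_system B R \/
     [/\ locally_extended_affine_root_system B R,
         form_radical B = [set 0] & locally_finite_root_system R]).
Proof.
move=> [sq conn anis] norm_rat _ lambda_int lambda_anis V R.
have [B BE] := exists_rational_form charK sq norm_rat.
exists B; split=> //.
have [phi phiE] := exists_rational_weight charK sq norm_rat lambda_int.
pose P := [set v : V | weight (root_of v)].
have r0 : ratr 0 = 0 :> K by rewrite -[0]/(0%:~R) ratr_int.
have B0 u v : (B u v == 0) = (dual_form kappa (root_of u) (root_of v) == 0).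
  by rewrite -BE -r0 (inj_eq (ratr_char0_inj charK)).
have repr (v : V) : representable kappa (root_of v).
  exact: root_of_representable.
have cartanE a b : R a ->
    ratr (cartan_number B b a) = root_of b (coroot (root_of a)).
  move=> Ra; have N0 := integrable_norm_neq0 sq Ra.
  rewrite /cartan_number !(ratr_char0M charK) (ratrV charK) (ratr2 K) !BE.
  rewrite dual_formC (dual_form_integrable charK sq Ra (repr b)).
  by field; rewrite N0 -[2]/(2%:R) (natr_char0_eq0 charK).
apply: (@affine_or_finite V B R P phi).
- move=> v; split=> [Rv|[Pv]].
    by split; [apply: integrable_weight|rewrite B0 integrable_norm_neq0].
  rewrite B0 => v0; apply: anis => //; split=> //.
  apply: contraNneq v0 => ->; rewrite dual_formE //; last exact: representable0.
- move=> v Rv; have [q q0 Eq] := norm_rat _ Rv.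
  by rewrite (_ : B v v = q) //; apply: (ratr_char0_inj charK); rewrite BE.
- move=> a b Ra Pb; have [k Ek _] := weight_string charK sq Ra Pb; exists k.
  by apply: (ratr_char0_inj charK); rewrite cartanE // Ek ratr_int.
- move=> a b j Ra Pb; have [k Ek str] := weight_string charK sq Ra Pb.
  have -> : cartan_number B b a = k%:~R.
    by apply: (ratr_char0_inj charK); rewrite cartanE // Ek ratr_int.
  rewrite pmulrn ler_int => /str wba; change (weight (root_of (b - j%:R *: a))).
  by rewrite root_of_subMn.
- move=> C [a Ra Ca] stepC b Rb.
  have [s [sR]] := conn _ _ Ra Rb.
  elim: s a Ra Ca sR => [|gam s IHs] a Ra Ca sR /=.
    by move=> _ /root_of_inj <-.
  move=> /andP[gam0 pth] lst.
  have gi : integrable_root gam by apply: sR; rewrite mem_head.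
  have [c Ec] := root_lift charK gi; rewrite -Ec in gi gam0 pth lst.
  apply: IHs pth lst => //; last by move=> d ds; apply: sR; rewrite inE ds orbT.
  apply: (stepC a) => //.
  rewrite symformC B0 (dual_form_integrable charK sq Ra) //.
  rewrite !mulf_neq0 ?integrable_norm_neq0 ?invr_eq0 //.
  by rewrite -[2]/(2%:R) (natr_char0_eq0 charK).
- exact: integrable_span.
- move=> v Pv v0 phi0; apply/eqP; apply: contraT => vn0.
  have vi : integrable_root (root_of v).
    apply: lambda_anis; split; last by rewrite -phiE phi0.
    split; last exact: Pv.
    apply: contra_neq vn0 => v0'; apply: root_of_inj.
    by rewrite v0' root_of0.
  by have := integrable_norm_neq0 sq vi; rewrite -B0 v0 eqxx.
- move=> v Rv; have [k Ek] := lambda_int _ Rv; exists k.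
  apply: (ratr_char0_inj charK); rewrite ratr_int -Ek.
  rewrite !(ratr_char0M charK) (ratrV charK) (ratr2 K) BE phiE.
  have N0 := integrable_norm_neq0 sq Rv.
  rewrite (pairing_coroot charK sq Rv).
  by field; rewrite N0 -[2]/(2%:R) (natr_char0_eq0 charK).
Qed.
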